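(* Suppose $2\le q\le n^{1/2-\varepsilon}$ for some $\varepsilon>0$. There exist a constant $c\equiv c(\varepsilon)>0$ and a universal constant $C>0$ such that if $D\le n^{c}$ then $$\inf_{\widehat M\in\mathbb R[Y]_{\le D}^{n\times n}}\ \sup_{M\in\mathcal M_q}\ \mathbb E\big[\ell(\widehat M,M)\big]\ \ge\ \frac{Cq}{n}.$$
   Context: For integers $n,q$, define the class of block-model edge-probability matrices $$\mathcal M_q=\Big\{M\in[0,1]^{n\times n}: M_{i,j}=Q_{z_i,z_j}\mathbf 1\{i\ne j\}\text{ for some } Q=Q^\top\in[0,1]^{q\times q},\ z\in[q]^n\Big\}.$$ Given $M\in\mathcal M_q$, the observation is the adjacency matrix $Y\in\{0,1\}^{n\times n}$ of a random graph: $Y$ is symmetric, $Y_{i,i}=0$, and $(Y_{i,j})_{i<j}$ are independent with $\mathbb P(Y_{i,j}=1)=M_{i,j}$; $\mathbb E$ denotes expectation over $Y$. The notation $\widehat M\in\mathbb R[Y]_{\le D}^{n\times n}$ means that each entry $\widehat M_{i,j}$ is a real multivariate polynomial in the entries of $Y$ of degree at most $D$. The loss is $$\ell(\widehat M,M)=\binom n2^{-1}\sum_{1\le i<j\le n}(\widehat M_{i,j}-M_{i,j})^2 .$$ *)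

(* Defs.v *)
From HB Require Import structures.
From mathcomp Require Import all_boot all_order all_algebra.
From mathcomp Require Import boolp classical_sets reals constructive_ereal ereal exp.
From mathcomp Require mpoly.
(* The notations of mpoly clash with those of the analysis library. *)
Import -(notations) mpoly.

Set Implicit Arguments.
Unset Strict Implicit.
Unset Printing Implicit Defensive.

Import Order.TTheory GRing.Theory Num.Theory.
Local Open Scope ring_scope.

Definition block_model (R : realType) (n q : nat) (M : 'M[R]_n) : Prop :=
  (forall i j, 0 <= M i j <= 1) /\
  exists (Q : 'M[R]_q) (z : 'I_n -> 'I_q),
    [/\ Q^T = Q, (forall a b, 0 <= Q a b <= 1)
      & forall i j, M i j = Q (z i) (z j) * (i != j)%:R].

Definition is_adjacency (n : nat) (A : 'M[bool]_n) : bool :=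
  (A^T == A) && [forall i, ~~ A i i].

(* The law of [Y]: the entries above the diagonal are independent Bernoulli
   variables with parameters [M i j], so a simple graph has the product mass. *)
Definition graph_prob (R : realType) (n : nat) (M : 'M[R]_n)
    (A : 'M[bool]_n) : R :=
  \prod_(i < n) \prod_(j < n | (i < j)%N)
    (if A i j then M i j else 1 - M i j).

Definition graph_expectation (R : realType) (n : nat) (M : 'M[R]_n)
    (f : 'M[bool]_n -> R) : R :=
  \sum_(A : 'M[bool]_n | is_adjacency A) graph_prob M A * f A.

(* One indeterminate per entry of [Y], numbered row by row as in [mxvec]. *)
Definition poly_estimator (R : realType) (n : nat) : Type :=
  'M[mpoly.mpoly (n * n) R]_n.

(* [msize] is the total degree plus one, and is 0 on the zero polynomial. *)
Definition degree_le (R : realType) (n D : nat) (P : poly_estimator R n) : Prop :=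
  forall i j, (mpoly.msize (P i j) <= D.+1)%N.

Definition estimate (R : realType) (n : nat) (P : poly_estimator R n)
    (A : 'M[bool]_n) : 'M[R]_n :=
  let Y : 'M[R]_n := \matrix_(i, j) (A i j)%:R in
  \matrix_(i, j) mpoly.meval (fun k => mxvec Y 0 k) (P i j).

Definition loss (R : realType) (n : nat) (Mhat M : 'M[R]_n) : R :=
  'C(n, 2)%:R^-1 *
  \sum_(i < n) \sum_(j < n | (i < j)%N) (Mhat i j - M i j) ^+ 2.

Definition risk (R : realType) (n : nat) (P : poly_estimator R n)
    (M : 'M[R]_n) : R :=
  graph_expectation M (fun A => loss (estimate P A) M).

(* Infimum and supremum are taken in the extended reals, so that neither
   depends on a default value for unbounded sets. *)
Definition minimax_risk (R : realType) (n q D : nat) : \bar R :=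
  ereal_inf [set ereal_sup [set (risk P M)%:E | M in [set M | block_model q M]]
            | P in [set P : poly_estimator R n | degree_le D P]]%classic.

(* Main.v *)
Require Import Defs.
From HB Require Import structures.
From mathcomp Require Import all_boot all_order all_algebra.
From mathcomp Require Import reals constructive_ereal ereal exp.
From mathcomp Require Import ring lra zify.
From mathcomp Require mpoly.
Import -(notations) mpoly.

(** The supremum over block models is at least the average over a random one.
    Give every vertex a uniform class among [Q = q / 2] and a uniform sign, and
    let the edge [ij] have probability [1/2 + t/2 * X_ij], where [X_ij] is the
    product of the two signs if the classes agree and 0 otherwise.  The pairs
    (class, sign) are the blocks.  For [t^2 = Q^2 / (8 n)] the variance of an
    edge probability is [t^2 / (4 Q) = Q / (32 n)], so it is enough that
    polynomials of degree at most [D] explain at most half of it.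

    Fix an edge [e0] and a polynomial [f] of degree at most [D] in the signs
    [1] and [-1] that encode presence and absence of the edges.  Given the
    labels, the products of the variables centred at their means [t * X_e] are
    orthogonal ([bernoulli_parseval]).  Jensen's inequality over the labels then
    gives [E f^2 >= \sum_B (1 - t^2)^|B| * b_B^2], where the averaged
    coefficients [b_B] are linear in [f].  The correlation is
    [E (f * X_e0) = \sum_B kappa_B * t^|B| * b_B], where the cumulants [kappa]
    solve the triangular system
    [\sum_(B <= A) kappa_B * E X^(A - B) = E (X_e0 * X^A)].  Completing squares,
    [f] gains at most [t^2 / 4 * W] over a constant, with
    [W = \sum_(|A| <= D) kappa_A^2 * (t^2 / (1 - t^2))^|A|]
    ([estimation_lower_bound]).

    It remains to prove [W <= 1 / (2 n)] ([kappa_sum_le]).  Flipping the sign of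
    one vertex shows that [E X^A] vanishes unless all degrees of [A] are even,
    and hence that [kappa_A] vanishes unless [A] and [e0] have the same odd
    vertices.  As labels of disjoint vertex sets are independent, [kappa_A] also
    vanishes unless [A] is connected to [e0].  By Euler's theorem such an [A] is
    the edge set of a trail between the ends of [e0] ([euler_trail]).  Let [k]
    be the number of steps of this trail that lead to a vertex already seen.
    These [k] edges form the complement of a spanning tree, so an even subgraph
    of [A] is determined by the ones that it contains; unrolling the recursion
    for the cumulants then costs a factor at most [(k + 1)^k] and
    [|kappa_A| <= (k + 1)^k * Q^-(|A| - k)] ([kappa_walk]).  A step to a vertex
    already seen has at most [|A|] choices instead of [n], whence the sum of
    [theta^k] over all trails of length [e] is at most
    [(n + e * theta)^(e - 1)] ([sum_revisits_le]).  With [theta = D^2 * Q^2] this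
    is at most [(2 n)^(e - 1)] as soon as [D^3 * Q^2 <= n], and [W] is dominated
    by a geometric series.  The last condition is where [q <= n^(1/2 - eps)] and
    [D <= n^(eps / 2)] enter. *)

Set Implicit Arguments.
Unset Strict Implicit.
Unset Printing Implicit Defensive.

Import Order.TTheory GRing.Theory Num.Theory.
Local Open Scope ring_scope.

(** * Finite sums *)

Section FiniteSums.

(** Passes from a sum over graphs [i] to a sum over walks [j]: each graph that
    contributes is charged to one of the walks that trace it. *)
Lemma ler_sum_cover (R : numDomainType) (I J : finType) (P : pred I)
    (h : J -> I) (F : I -> R) (H : J -> R) :
    (forall j, 0 <= H j) ->
    (forall i, P i -> F i != 0 -> exists2 j, h j = i & F i <= H j) ->
  \sum_(i | P i) F i <= \sum_j H j.
Proof.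
move=> H_ge0 cover.
rewrite (partition_big h predT) //= [leRHS](bigID P) /=.
apply: ler_wpDr; first by apply: sumr_ge0 => i _; apply: sumr_ge0.
apply: ler_sum => i Pi; have [->|Fi0] := eqVneq (F i) 0; first exact: sumr_ge0.
have [j hj leFH] := cover i Pi Fi0.
by rewrite (bigD1 j) ?hj //= ler_wpDr // sumr_ge0.
Qed.

Lemma prod_addr_subsets (R : comPzRingType) (I : finType) (A : {set I})
    (F G : I -> R) :
  \prod_(i in A) (F i + G i) =
  \sum_(J : {set I} | J \subset A)
    \prod_(i in J) F i * \prod_(i in A :\: J) G i.
Proof.
pose F' i := if i \in A then F i else 0; pose G' i := if i \in A then G i else 1.
have -> : \prod_(i in A) (F i + G i) = \prod_i (F' i + G' i).
  rewrite big_mkcond; apply: eq_bigr => i _; rewrite /F' /G'.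
  by case: ifP => // _; rewrite add0r.
rewrite bigA_distr [RHS]big_mkcond; apply: eq_bigr => J _.
case: ifPn => [sJA | /subsetPn[i iJ iNA]]; last first.
  by rewrite (bigD1 i) //= iJ /F' (negbTE iNA) mul0r.
rewrite (bigID [in J]) /=; congr (_ * _).
  by apply: eq_bigr => i iJ; rewrite iJ /F' (subsetP sJA).
rewrite [RHS]big_mkcond [LHS]big_mkcond; apply: eq_bigr => i _.
by rewrite !inE /G'; case: (i \in J).
Qed.

Lemma sum_exp_subsets (R : comPzRingType) (I : finType) (A : {set I}) (x : R) :
  \sum_(J : {set I} | J \subset A) x ^+ (#|A| - #|J|) = (1 + x) ^+ #|A|.
Proof.
rewrite -prodr_const (prod_addr_subsets A (fun=> 1) (fun=> x)).
apply: eq_bigr => J sJA; rewrite big1 // mul1r prodr_const.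
by rewrite cardsD (setIidPr sJA).
Qed.

Lemma sum_tuple_cons (R : nmodType) (T : finType) (m : nat)
    (F : seq T -> R) :
  \sum_(w : m.+1.-tuple T) F w = \sum_x \sum_(w : m.-tuple T) F (x :: w).
Proof.
rewrite pair_big /=.
pose f (xw : T * m.-tuple T) := [tuple of xw.1 :: xw.2].
rewrite (reindex f) /=; first by [].
exists (fun w => (thead w, [tuple of behead w])) => [[x w] _ | w _].
  by congr pair; apply: val_inj.
by rewrite [RHS]tuple_eta; apply: val_inj.
Qed.

End FiniteSums.

(** * Trails and Euler's theorem *)

Section Trails.
Variables (V E : finType) (src tgt : E -> V).

Definition joins (e : E) (x y : V) : bool :=
  (src e == x) && (tgt e == y) || (src e == y) && (tgt e == x).

(** Written with an exclusive or, so that a loop contributes nothing and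
    [boundary] is the boundary map of chains modulo 2. *)
Definition incident (e : E) (v : V) : bool := (src e == v) (+) (tgt e == v).

(** The parity of the degree of [v] in the graph [A]. *)
Definition boundary (A : {set E}) (v : V) : bool :=
  \big[addb/false]_(e in A) incident e v.

Fixpoint trail (x : V) (p : seq (E * V)) : bool :=
  if p is (e, y) :: p' then joins e x y && trail y p' else true.

Lemma incident_joins e x y v :
  joins e x y -> incident e v = (x == v) (+) (y == v).
Proof. by case/orP=> /andP[/eqP<- /eqP<-] //; rewrite /incident addbC. Qed.

Lemma boundaryD1 (A : {set E}) e v :
  e \in A -> boundary A v = incident e v (+) boundary (A :\ e) v.
Proof.
move=> eA; rewrite /boundary (bigD1 e) //=; congr (_ (+) _).
by apply: eq_bigl => f; rewrite !inE andbC.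
Qed.

Lemma boundaryID (A B : {set E}) v : B \subset A ->
  boundary A v = boundary B v (+) boundary (A :\: B) v.
Proof.
move=> sBA; rewrite /boundary (big_setID B) /=; congr (_ (+) _).
by rewrite (setIidPr sBA).
Qed.

Lemma trail_cat x p1 p2 :
  trail x (p1 ++ p2) = trail x p1 && trail (last x (unzip2 p1)) p2.
Proof. by elim: p1 x => [|[e y] p1 IHp] x //=; rewrite IHp andbA. Qed.

Lemma boundary_trail x (p : seq (E * V)) v : trail x p -> uniq (unzip1 p) ->
  boundary [set e in unzip1 p] v = (x == v) (+) (last x (unzip2 p) == v).
Proof.
move=> tr_p uniq_p; rewrite /boundary.
rewrite (eq_bigl [in unzip1 p]); last by move=> e; rewrite inE.
rewrite -big_uniq //; elim: p x tr_p {uniq_p} => [|[e y] p IHp] x /=.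
  by rewrite big_nil addbb.
case/andP=> jxy /IHp eq_p; rewrite big_cons eq_p (incident_joins _ jxy).
by case: (y == v); case: (x == v); case: (_ == v).
Qed.

Lemma trail_split x (p : seq (E * V)) w : w \in x :: unzip2 p ->
  exists p1 p2, p = p1 ++ p2 /\ last x (unzip2 p1) = w.
Proof.
elim: p x => [|[e y] p IHp] x /=.
  by rewrite inE => /eqP->; exists [::], [::].
rewrite inE => /orP[/eqP->|/IHp[p1 [p2 [-> <-]]]];
  first by exists [::], ((e, y) :: p).
by exists ((e, y) :: p1), p2.
Qed.

Lemma trail_ends x (p : seq (E * V)) e : trail x p -> e \in unzip1 p ->
  (src e \in x :: unzip2 p) && (tgt e \in x :: unzip2 p).
Proof.
elim: p x => [|[f y] p IHp] x //= /andP[jxy tr_p]; rewrite inE.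
case/orP=> [/eqP->|/(IHp _ tr_p)/andP[es et]].
  by case/orP: jxy => /andP[/eqP<- /eqP<-]; rewrite !inE !eqxx ?orbT.
by rewrite inE es orbT inE et orbT.
Qed.

(** Walk from [a] along unused edges until stuck.  Removing the traversed edge
    moves the odd vertex [a] to its other end, and a walk can only be stuck at a
    vertex of even remaining degree, which is [b].  The last clause says that a
    closed trail is nontrivial whenever it can start. *)
Lemma trail_of_boundary (U : {set E}) a b :
    (forall v, boundary U v = (a == v) (+) (b == v)) ->
  exists p : seq (E * V), [/\ trail a p, last a (unzip2 p) = b, uniq (unzip1 p),
    {subset unzip1 p <= U}
    & (exists2 e, e \in U & (src e == a) || (tgt e == a)) -> p != [::]].
Proof.
have [m] := ubnP #|U|; elim: m U a => // m IHm U a leUm bdU.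
case: (pickP (fun e => (e \in U) && ((src e == a) || (tgt e == a)))) => [e|noe].
  case/andP=> eU ea.
  have [y jay] : exists y, joins e a y.
    by case/orP: ea => ea; [exists (tgt e) | exists (src e)];
       rewrite /joins ea eqxx ?orbT.
  have bdU' v : boundary (U :\ e) v = (y == v) (+) (b == v).
    have := bdU v; rewrite (boundaryD1 v eU) (incident_joins v jay).
    by case: (a == v); case: (y == v); case: (b == v); case: boundary.
  have ltU' : (#|U :\ e| < m)%N by move: leUm; rewrite (cardsD1 e U) eU.
  have [p [tr_p last_p uniq_p sub_p _]] := IHm _ _ ltU' bdU'.
  exists ((e, y) :: p); split=> //=; first by rewrite jay.
    rewrite uniq_p andbT; apply/negP => /sub_p; by rewrite !inE eqxx.
  move=> f; rewrite inE => /orP[/eqP->//|/sub_p].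
  by rewrite !inE => /andP[].
exists [::]; split=> //=; last first.
  by case=> e eU ea; have := noe e; rewrite eU ea.
have := bdU a; rewrite eqxx /boundary big1 => [|e eU].
  by case: eqP => // ->.
have := noe e; rewrite eU /= /incident => /negbT.
by rewrite negb_or => /andP[/negbTE-> /negbTE->].
Qed.

(** A trail that misses an edge of [A] touching one of its vertices [w] can be
    lengthened: what is left of [A] is even, so it contains a closed trail
    through [w], which is spliced in.  When no such edge remains, the vertices of
    the trail are closed under [A], and connectedness, in the form of the second
    hypothesis, leaves no edge elsewhere. *)
Lemma euler_trail (A : {set E}) a b :
    (forall v, boundary A v = (a == v) (+) (b == v)) ->
    (forall S : {set V}, a \in S -> b \in S ->
       {in A, forall e, (src e \in S) = (tgt e \in S)} ->
       {in A, forall e, src e \in S}) ->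
  exists p : seq (E * V), [/\ trail a p, last a (unzip2 p) = b, uniq (unzip1 p)
    & [set e in unzip1 p] = A].
Proof.
move=> bdA connA.
have [p0 [tr0 last0 uniq0 sub0 _]] := trail_of_boundary bdA.
have [m] := ubnP (#|A| - size p0).
elim: m p0 tr0 last0 uniq0 sub0 => // m IHm p tr_p last_p uniq_p sub_p lt_m.
pose pE := [set e in unzip1 p]; pose S := [set v in a :: unzip2 p].
have sub_pE : pE \subset A by apply/subsetP => e; rewrite inE => /sub_p.
case: (pickP (fun e => (e \in A :\: pE) && ((src e \in S) || (tgt e \in S)))).
  move=> e /andP[eU eS].
  have [w wS ew] : exists2 w, w \in S & (src e == w) || (tgt e == w).
    by case/orP: eS => eS; [exists (src e)|exists (tgt e)]; rewrite ?eqxx ?orbT.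
  have bdU v : boundary (A :\: pE) v = (w == v) (+) (w == v).
    have := boundaryID v sub_pE;
      rewrite bdA (boundary_trail _ tr_p uniq_p) last_p addbb.
    by case: (a == v); case: (b == v); case: boundary.
  have [q [tr_q last_q uniq_q sub_q q0]] := trail_of_boundary bdU.
  have {q0} q0 : q != [::] by apply: q0; exists e.
  move: wS; rewrite inE => /trail_split[p1 [p2 [def_p last_p1]]].
  have disj f : f \in unzip1 q -> f \notin unzip1 p.
    by move/sub_q; rewrite !inE => /andP[].
  have perm12 : perm_eq (unzip1 (p1 ++ q ++ p2)) (unzip1 q ++ unzip1 p).
    by rewrite def_p /unzip1 !map_cat perm_catCA.
  apply: (IHm (p1 ++ q ++ p2)).
  - move: tr_p; rewrite def_p !trail_cat last_p1 last_q => /andP[-> ->].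
    by rewrite tr_q.
  - by rewrite /unzip2 !map_cat !last_cat -/unzip2 last_p1 last_q -last_p
         def_p /unzip2 map_cat last_cat -/unzip2 last_p1.
  - rewrite (perm_uniq perm12) cat_uniq uniq_q uniq_p andbT /=.
    by apply/hasPn => f fp; apply: contraL fp; apply: disj.
  - move=> f; rewrite (perm_mem perm12) mem_cat => /orP[/sub_q|/sub_p//].
    by rewrite !inE => /andP[].
  have szq : (0 < size q)%N by rewrite lt0n size_eq0.
  have szp : (size p < #|A|)%N.
    have [eA eNp] : e \in A /\ e \notin pE by move: eU; rewrite inE => /andP[].
    have <- : #|pE| = size p.
      rewrite -(size_map fst p) -(card_uniqP uniq_p).
      by apply: eq_card => f; rewrite inE.
    by apply: proper_card; apply/properP; split=> //; exists e.
  rewrite !size_cat addnCA -size_cat -def_p.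
  apply: leq_trans (_ : #|A| - size p <= m)%N; last by rewrite -ltnS.
  by apply: ltn_sub2l => //; rewrite -[X in (X < _)%N]add0n ltn_add2r.
move=> noe; exists p; split=> //.
have in_p e : e \in A -> (src e \in S) || (tgt e \in S) -> e \in unzip1 p.
  move=> eA eS; have := noe e; rewrite eS andbT !inE eA andbT.
  by move/negbT; rewrite negbK.
have closedS : {in A, forall e, (src e \in S) = (tgt e \in S)}.
  move=> e eA; apply/idP/idP => eS.
    have /(trail_ends tr_p)/andP[_] : e \in unzip1 p by rewrite in_p ?eS.
    by rewrite [_ \in S]inE.
  have /(trail_ends tr_p)/andP[+ _] : e \in unzip1 p by rewrite in_p ?eS ?orbT.
  by rewrite [_ \in S]inE.
have aS : a \in S by rewrite !inE eqxx.
have bS : b \in S by rewrite inE -last_p mem_last.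
apply/eqP; rewrite eqEsubset sub_pE; apply/subsetP => e eA.
by rewrite inE in_p // (connA S aS bS closedS).
Qed.

(** The visited set [S] grows along the walk, so this counts the steps to a
    vertex seen before. *)
Fixpoint revisits (S : {set V}) (w : seq V) : nat :=
  if w is y :: w' then ((y \in S) + revisits (y |: S) w')%N else 0%N.

(** The edges of a trail that lead back to a visited vertex; the remaining edges
    form a spanning tree of the graph traced by the trail. *)
Fixpoint chords (S : {set V}) (p : seq (E * V)) : seq E :=
  if p is (e, y) :: p' then
    if y \in S then e :: chords S p' else chords (y |: S) p'
  else [::].

Lemma setU1_id (S : {set V}) y : y \in S -> y |: S = S.
Proof. by move=> yS; apply/setUidPr; rewrite sub1set. Qed.

Lemma size_chords S p : size (chords S p) = revisits S (unzip2 p).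
Proof.
elim: p S => [|[e y] p IHp] S //=; case: ifP => yS /=; last exact: IHp.
by rewrite IHp setU1_id.
Qed.

(** Each step either is a revisit or adds a vertex. *)
Lemma revisitsE S w :
  (revisits S w + #|S :|: [set x in w]| = size w + #|S|)%N.
Proof.
elim: w S => [|y w IHw] S /=.
  by rewrite (_ : [set x in [::]] = set0) ?setU0 //; apply/setP=> x; rewrite !inE.
have -> : S :|: [set x in y :: w] = (y |: S) :|: [set x in w].
  by apply/setP=> x; rewrite !inE; case: (x == y); case: (x \in S).
by rewrite -addnA IHw cardsU1; case: (y \in S);
  rewrite /= ?add0n ?add1n ?addnS ?addSn.
Qed.

(** An even graph inside a tree is empty.  The tree is explored in the order of
    the trail: a tree edge [e] discovers its end [y], and if [B] has no later
    edge then [y] has degree at most one in [B], hence [e] is not in [B]. *)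
Lemma chords_meet_even (S : {set V}) x (p : seq (E * V)) (B : {set E}) :
    x \in S -> trail x p -> uniq (unzip1 p) -> {subset B <= unzip1 p} ->
    (forall v, v \notin S -> boundary B v = false) ->
    {in chords S p, forall e, e \notin B} ->
  B = set0.
Proof.
elim: p x S B => [|[e y] p IHp] x S B xS /=.
  by move=> _ _ sB _ _; apply/setP=> e; rewrite inE; apply/negP=> /sB.
case/andP=> jxy tr_p /andP[eNp uniq_p] sB evenB.
case: ifP => yS chB.
  have eNB : e \notin B by apply: chB; rewrite inE eqxx.
  apply: (IHp y S) => // [f fB | f fch]; last by apply: chB; rewrite inE fch orbT.
  by have := sB f fB; rewrite inE => /orP[/eqP def_f|//]; rewrite -def_f fB in eNB.
have neq_xy : x != y by apply/eqP => eq_xy; rewrite -eq_xy xS in yS.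
have B'0 : B :\ e = set0.
  apply: (IHp y (y |: S)) => //; first by rewrite !inE eqxx.
  - by move=> f; rewrite !inE => /andP[/negbTE neq_fe /sB]; rewrite inE neq_fe.
  - move=> v; rewrite !inE negb_or => /andP[neq_vy vS].
    have := evenB v vS; case eB: (e \in B).
      rewrite (boundaryD1 v eB) (incident_joins v jxy).
      by case: eqP => [def_v|_]; rewrite -?def_v ?xS // in vS *;
         rewrite eq_sym (negbTE neq_vy).
    by rewrite (_ : B :\ e = B) //; apply/setP=> f; rewrite !inE;
       case: eqP => // ->; rewrite eB.
  by move=> f fch; rewrite !inE (negbTE (chB f fch)) andbF.
apply/setP => f; rewrite inE; apply/negbTE/negP => fB.
have [def_f|neq_fe] := eqVneq f e; last first.
  by have := in_set0 f; rewrite -B'0 !inE neq_fe fB.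
have := evenB y (negbT yS); rewrite (@boundaryD1 B e) -?def_f // def_f B'0.
by rewrite /boundary big_set0 (incident_joins y jxy) eqxx (negbTE neq_xy).
Qed.

End Trails.

(** * Moments of the planted signal *)

(** The product formula [#|A + B| * #|A :&: B| = #|A| * #|B|] for subgroups,
    with [A + B] replaced by the whole group: the fibres of [(a, b) |-> a - b]
    embed into [A :&: B]. *)
Lemma card_subgroups_le (V : finType) (G : finZmodType)
    (A B : {set {ffun V -> G}}) :
    {in A &, forall x y, x - y \in A} -> {in B &, forall x y, x - y \in B} ->
  (#|A| * #|B| <= #|{: {ffun V -> G}}| * #|A :&: B|)%N.
Proof.
move=> subA subB; rewrite -cardsX -sum1_card.
rewrite (partition_big (fun ab => ab.1 - ab.2 : {ffun V -> G}) predT) //=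
  -sum_nat_const.
apply: leq_sum => d _; rewrite sum1_card.
set F := (X in (#|X| <= _)%N).
case: (pickP F) => [[a0 b0] | F0]; last by rewrite eq_card0.
case/andP; rewrite inE /= => /andP[a0A b0B] /eqP def_d.
have inF ab : ab \in F -> [/\ ab.1 \in A, ab.2 \in B & ab.1 - a0 = ab.2 - b0].
  case/andP; rewrite inE => /andP[aA bB] /eqP eq_d; split=> //.
  have : ab.1 - ab.2 = a0 - b0 by rewrite eq_d def_d.
  move/eqP; rewrite subr_eq => /eqP ->.
  by rewrite -[a0 - _ + _]addrA [LHS]addrC addKr addrC.
rewrite -(card_in_image (f := fun ab : {ffun V -> G} * {ffun V -> G} => ab.1 -
  a0 : {ffun V -> G})); last first.
  move=> [a b] [a' b'] /inF[/= _ _ eq_ab] /inF[/= _ _ eq_ab'] eq_a.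
  congr pair; first exact: (addIr (- a0)).
  by apply: (addIr (- b0)); rewrite -eq_ab -eq_ab'.
apply: subset_leq_card; apply/subsetP=> _ /imageP[ab /inF[aA bB eq_ab] ->].
by rewrite inE subA // eq_ab subB.
Qed.

Section Moments.
Variables (R : realFieldType) (V E : finType) (src tgt : E -> V) (Q : nat).
Local Notation boundary := (boundary src tgt).
Local Notation group_label := {ffun V -> 'I_Q.+1}.
Definition labelling : Type := ({ffun V -> 'I_Q.+1} * {ffun V -> bool})%type.
HB.instance Definition _ := Finite.on labelling.

(** The signal [X_e] carried by an edge: class agreement times the product of
    the signs. *)
Definition spin (l : labelling) (e : E) : R :=
  if l.1 (src e) == l.1 (tgt e) then (-1) ^+ (l.2 (src e) (+) l.2 (tgt e))
  else 0.

Definition spins (l : labelling) (A : {set E}) : R := \prod_(e in A) spin l e.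

Definition mean (f : labelling -> R) : R := #|{: labelling}|%:R^-1 * \sum_l f l.

Definition constant_on (A : {set E}) : {set group_label} :=
  [set g : group_label | [forall e in A, g (src e) == g (tgt e)]].

(** A product of spins vanishes where the classes disagree, so this probability
    bounds every moment of the spins on [A]. *)
Definition coincidence (A : {set E}) : R :=
  #|constant_on A|%:R / #|{: group_label}|%:R.

Lemma constant_onP (A : {set E}) (g : group_label) :
  reflect {in A, forall e, g (src e) = g (tgt e)} (g \in constant_on A).
Proof. by rewrite inE; apply: (iffP forall_inP) => gA e /gA /eqP. Qed.

Lemma card_labels_gt0 : 0 < #|{: group_label}|%:R :> R.
Proof. by rewrite ltr0n; apply/card_gt0P; exists [ffun=> ord0]. Qed.

Lemma card_labelling_gt0 : 0 < #|{: labelling}|%:R :> R.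
Proof.
by rewrite ltr0n; apply/card_gt0P; exists ([ffun=> ord0], [ffun=> true]).
Qed.

Lemma coincidence_ge0 A : 0 <= coincidence A.
Proof. by rewrite divr_ge0 ?ler0n. Qed.

(** The classes constant along [A] form a subgroup, once the classes are read as
    integers modulo [Q.+1]; intersecting subgroups of two graphs gives that of
    their union. *)
Lemma coincidenceM_le (A B : {set E}) :
  coincidence A * coincidence B <= coincidence (A :|: B).
Proof.
have subC C : {in constant_on C &, forall g h, g - h \in constant_on C}.
  move=> g h /constant_onP gC /constant_onP hC; apply/constant_onP=> e eC.
  by rewrite !ffunE gC ?hC.
rewrite /coincidence ler_pdivlMr ?card_labels_gt0 //.
rewrite -mulrA divfK ?gt_eqF ?card_labels_gt0 // mulrAC.
rewrite ler_pdivrMr ?card_labels_gt0 // -!natrM ler_nat [leqRHS]mulnC.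
apply: leq_trans (card_subgroups_le (subC A) (subC B)) _.
rewrite leq_mul2l; apply/orP; right; apply: subset_leq_card.
apply/subsetP => g; rewrite inE => /andP[/constant_onP gA /constant_onP gB].
by apply/constant_onP => e; rewrite inE => /orP[/gA|/gB].
Qed.

Lemma mean_le (f g : labelling -> R) : (forall l, f l <= g l) -> mean f <= mean g.
Proof. by move=> le_fg;
  rewrite ler_pM2l ?invr_gt0 ?card_labelling_gt0 ?ler_sum. Qed.

Lemma mean_const (a : R) : mean (fun=> a) = a.
Proof.
rewrite /mean sumr_const -[a *+ _]mulr_natl mulrA mulVf ?mul1r //.
by rewrite gt_eqF ?card_labelling_gt0.
Qed.

Lemma mean_sum (I : Type) (r : seq I) (P : pred I) (F : I -> labelling -> R) :
  mean (fun l => \sum_(i <- r | P i) F i l) = \sum_(i <- r | P i) mean (F i).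
Proof. by rewrite /mean exchange_big /= mulr_sumr. Qed.

Lemma meanZ a (f : labelling -> R) : mean (fun l => a * f l) = a * mean f.
Proof. by rewrite /mean -mulr_sumr mulrCA. Qed.

Lemma eq_mean (f g : labelling -> R) : f =1 g -> mean f = mean g.
Proof. by move=> eq_fg; rewrite /mean (eq_bigr _ (fun l _ => eq_fg l)). Qed.

Lemma meanD (f g : labelling -> R) :
  mean (fun l => f l + g l) = mean f + mean g.
Proof. by rewrite /mean big_split mulrDr. Qed.

Lemma mean_norm_le (f : labelling -> R) : `|mean f| <= mean (fun l => `|f l|).
Proof.
rewrite /mean normrM ger0_norm ?invr_ge0 ?ler0n //.
by rewrite ler_wpM2l ?invr_ge0 ?ler0n ?ler_norm_sum.
Qed.

Lemma mean_sqr_le (f : labelling -> R) : mean f ^+ 2 <= mean (fun l => f l ^+ 2).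
Proof.
set a := mean f.
have : mean (fun=> 0) <= mean (fun l => (f l - a) ^+ 2).
  by apply: mean_le => l; rewrite sqr_ge0.
rewrite mean_const.
rewrite (eq_mean (g := fun l => f l ^+ 2 + (- (a *+ 2) * f l + a ^+ 2))).
  rewrite !meanD meanZ mean_const -/a; move: (mean _) => m.
  by rewrite mulNr mulr2n mulrDl -!expr2 opprD addrNK subr_ge0.
by move=> l; rewrite sqrrB -addrA mulNr mulrnAl [f l * a]mulrC.
Qed.

Lemma mean_constant_on A :
  mean (fun l => (l.1 \in constant_on A)%:R) = coincidence A.
Proof.
rewrite /mean -(pair_big predT predT (fun g _ => (g \in constant_on A)%:R)) /=.
rewrite (eq_bigr _ (fun g _ => sumr_const _ _)) /= sumrMnl -natr_sum.
have -> : (\sum_g (g \in constant_on A))%N = #|constant_on A|.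
  by rewrite -sum1_card [RHS]big_mkcond; apply: eq_bigr => g _; case: ifP.
rewrite -[#|constant_on A|%:R *+ _]mulr_natr card_prod natrM invfM mulrCA divfK //.
by rewrite gt_eqF // ltr0n; apply/card_gt0P; exists [ffun=> true].
Qed.

Lemma spins_norm_le (l : labelling) (A : {set E}) :
  `|spins l A| <= (l.1 \in constant_on A)%:R.
Proof.
have [lA | /constant_onP lNA] := boolP (l.1 \in constant_on A).
  rewrite normr_prod prodr_ile1 // => e _; rewrite normr_ge0 /= /spin.
  by case: ifP => _; rewrite ?normr0 ?normr_sign.
suff -> : spins l A = 0 by rewrite normr0.
case: (pickP (fun e => (e \in A) && (l.1 (src e) != l.1 (tgt e)))) => [e|noe].
  by case/andP=> eA lNe; rewrite /spins (bigD1 e) //= /spin (negbTE lNe) mul0r.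
by case: lNA => e eA; have := noe e; rewrite eA /= => /negbFE/eqP.
Qed.

Definition moment (A : {set E}) : R := mean (spins^~ A).

Definition joint_moment (e0 : E) (A : {set E}) : R :=
  mean (fun l => spin l e0 * spins l A).

Lemma moment0 : moment set0 = 1.
Proof.
rewrite -[RHS]mean_const; apply: eq_mean => l.
by rewrite /spins big_set0.
Qed.

Lemma moment_norm_le A : `|moment A| <= coincidence A.
Proof.
rewrite -mean_constant_on; apply: le_trans (mean_norm_le _) _.
by apply: mean_le => l; apply: spins_norm_le.
Qed.

Lemma joint_moment_norm_le e0 A : `|joint_moment e0 A| <= coincidence (e0 |: A).
Proof.
rewrite -mean_constant_on; apply: le_trans (mean_norm_le _) _.
apply: mean_le => l; have [e0A | e0NA] := boolP (e0 \in A); last first.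
  by rewrite -(big_setU1 _ e0NA); apply: spins_norm_le.
rewrite (setU1_id e0A); apply: le_trans (spins_norm_le _ _).
rewrite normrM ler_piMl ?normr_ge0 // /spin.
by case: ifP => _; rewrite ?normr0 ?normr_sign.
Qed.

Definition flip (v : V) (l : labelling) : labelling :=
  (l.1, [ffun w => l.2 w (+) (v == w)]).

Lemma spin_flip v l e :
  spin (flip v l) e = (-1) ^+ incident src tgt e v * spin l e.
Proof.
rewrite /spin /flip /= !ffunE; case: ifP => _; last by rewrite mulr0.
rewrite -signr_addb /incident; congr (_ ^+ (nat_of_bool _)).
rewrite ![v == _]eq_sym.
by case: (src e == v); case: (tgt e == v); case: (l.2 _); case: (l.2 _).
Qed.

Lemma spins_flip v l A :
  spins (flip v l) A = (-1) ^+ boundary A v * spins l A.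
Proof.
rewrite /spins (eq_bigr _ (fun e _ => spin_flip v l e)) big_split /=.
congr (_ * _); rewrite /boundary.
rewrite (big_morph (fun b : bool => (-1) ^+ b : R) (id1 := 1) (op1 := *%R)) //.
exact: signr_addb.
Qed.

(** Flipping the sign of a vertex preserves the law of the labels. *)
Lemma mean_flip v (f : labelling -> R) :
  (forall l, f (flip v l) = - f l) -> mean f = 0.
Proof.
move=> f_flip; have flipK : involutive (flip v).
  case=> g x; congr pair; apply/ffunP => w.
  by rewrite !ffunE -addbA addbb addbF.
suff : mean f = - mean f.
  by move/eqP; rewrite -subr_eq0 opprK -mulr2n mulrn_eq0 => /eqP.
rewrite /mean -mulrN -sumrN (reindex_inj (inv_inj flipK)) /=.
by congr (_ * _); apply: eq_bigr => l _; rewrite f_flip.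
Qed.

Lemma moment_eq0 A v : boundary A v -> moment A = 0.
Proof. by move=> bA; apply: (mean_flip (v := v)) => l;
  rewrite spins_flip bA mulN1r. Qed.

Lemma joint_moment_eq0 e0 A v :
  boundary A v != incident src tgt e0 v -> joint_moment e0 A = 0.
Proof.
move=> bA; apply: (mean_flip (v := v)) => l; rewrite spins_flip spin_flip.
rewrite mulrACA -signr_addb addbC -negb_eqb bA.
by rewrite mulN1r.
Qed.

Definition depends_only_on (S : {set V}) (f : labelling -> R) : Prop :=
  forall l l' : labelling, {in S, l.1 =1 l'.1} -> {in S, l.2 =1 l'.2} ->
  f l = f l'.

(** Exchanging the labels off [S] between two independent labellings preserves
    their joint law, and turns [f l * g l'] into [f l * g l]. *)
Lemma mean_independent (S : {set V}) (f g : labelling -> R) :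
  depends_only_on S f -> depends_only_on (~: S) g -> mean (fun l => f l * g l)
    = mean f * mean g.
Proof.
move=> f_S g_S.
pose mix (l l' : labelling) : labelling :=
  ([ffun v => if v \in S then l.1 v else l'.1 v],
   [ffun v => if v \in S then l.2 v else l'.2 v]).
pose swap (ll : labelling * labelling) := (mix ll.1 ll.2, mix ll.2 ll.1).
have swapK : involutive swap.
  case=> [[g1 x1] [g2 x2]]; rewrite /swap /mix /=.
  by congr pair; congr pair; apply/ffunP => v; rewrite !ffunE; case: (v \in S).
have N0 : #|{: labelling}|%:R != 0 :> R by rewrite gt_eqF ?card_labelling_gt0.
have -> : mean f * mean g =
    #|{: labelling}|%:R^-1 ^+ 2 * \sum_ll f ll.1 * g ll.2.
  rewrite /mean mulrACA -expr2 mulr_suml; congr (_ * _).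
  by under eq_bigr do rewrite mulr_sumr; rewrite pair_big.
rewrite (reindex_inj (inv_inj swapK)) /=.
have -> : \sum_ll f (mix ll.1 ll.2) * g (mix ll.2 ll.1) =
    \sum_(l : labelling) \sum_(l' : labelling) f l * g l.
  rewrite pair_big; apply: eq_bigr => -[l l'] _ /=; congr (_ * _).
    by apply: f_S => v vS; rewrite ffunE vS.
  by apply: g_S => v; rewrite inE => /negbTE vS; rewrite ffunE vS.
under eq_bigr do rewrite sumr_const -mulr_natl.
by rewrite -mulr_sumr expr2 -mulrA mulKf.
Qed.

Lemma spins_depends_only_on (S : {set V}) (A : {set E}) :
  {in A, forall e, (src e \in S) && (tgt e \in S)} -> depends_only_on S (spins^~ A).
Proof.
move=> AS l l' eq1 eq2; apply: eq_bigr => e /AS/andP[sS tS].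
by rewrite /spin !eq1 ?eq2.
Qed.

(** The classes are recovered from the class of [src e0] and from the labelling
    in which this class is overwritten by that of [tgt e0]. *)
Lemma coincidence1_ge e0 : Q.+1%:R^-1 <= coincidence [set e0].
Proof.
rewrite /coincidence ler_pdivlMr ?card_labels_gt0 // mulrC.
rewrite ler_pdivrMr ?ltr0n // -natrM ler_nat.
pose f (g : group_label) : group_label * 'I_Q.+1 :=
  ([ffun w => if w == src e0 then g (tgt e0) else g w], g (src e0)).
rewrite -[X in (_ <= _ * X)%N]card_ord -[X in (_ <= _ * X)%N]cardsT -cardsX.
rewrite -(card_imset (f := f)) => [|g g' [/ffunP eq_g eq_s]]; last first.
  apply/ffunP => w; have := eq_g w; rewrite !ffunE.
  by case: (eqVneq w (src e0)) => [-> | _].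
apply: subset_leq_card; apply/subsetP => _ /imsetP[g _ ->]; rewrite !inE andbT.
apply/forall_inP => e; rewrite inE => /eqP ->.
by rewrite !ffunE eqxx; case: (eqVneq (tgt e0)).
Qed.

(** Adding to a labelling constant on [T] an arbitrary function supported on
    [T] minus a point is injective, so the former are at most
    [Q.+1 ^ (#|V| - (#|T| - 1))] in number. *)
Lemma coincidence_le (A : {set E}) (T : {set V}) a : a \in T ->
    (forall g, g \in constant_on A -> {in T, forall v, g v = g a}) ->
  coincidence A <= Q.+1%:R^-1 ^+ #|T|.-1.
Proof.
move=> aT constA; rewrite /coincidence ler_pdivrMr ?card_labels_gt0 //.
rewrite exprVn mulrC ler_pdivlMr ?exprn_gt0 ?ltr0n // -natrX -natrM ler_nat.
pose B := [set h in pffun_on (0 : 'I_Q.+1) (mem (T :\ a)) predT].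
have cardB : #|B| = (Q.+1 ^ #|T|.-1)%N.
  rewrite cardsE card_pffun_on (cardsD1 a T) aT /=.
  by congr (_ ^ _)%N; rewrite -[RHS]card_ord; apply: eq_card.
have BP (h : group_label) : reflect (forall v, v \notin T :\ a -> h v = 0) (h
  \in B).
  rewrite inE; apply: (iffP familyP) => hB v.
    move=> vNT; have := hB v; rewrite /= (negbTE vNT).
    by move/eqP.
  by have := hB v; case: ifP => // _ ->.
rewrite -cardB; apply: leq_trans (card_subgroups_le _ _) _.
- move=> g h /constant_onP gC /constant_onP hC; apply/constant_onP=> e eC.
  by rewrite !ffunE gC ?hC.
- move=> g h gB' hB'; apply/BP => v vN.
  have gB := elimT (BP g) gB'; have hB := elimT (BP h) hB'.
  by rewrite !ffunE gB ?hB // subrr.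
rewrite -[leqRHS]muln1 leq_mul2l; apply/orP; right.
rewrite -(cards1 (0 : {ffun V -> 'I_Q.+1})); apply: subset_leq_card.
apply/subsetP => g; rewrite in_setI in_set1 => /andP[gA gB'].
have gB := elimT (BP g) gB'; apply/eqP/ffunP => v; rewrite ffunE.
have ga : g a = 0 by apply: gB; rewrite !inE eqxx.
have [vT|vNT] := boolP (v \in T); last by apply: gB;
  rewrite !inE (negbTE vNT) andbF.
by rewrite (constA g gA v vT).
Qed.

End Moments.

(** * Cumulants *)

Section Cumulants.
Variables (R : comPzRingType) (E : finType) (mu c : {set E} -> R).

(** Solves the triangular system of [cumulant_sum] by recursion on [A]; the fuel
    [m] only has to exceed the number of edges. *)
Fixpoint cumulant_rec (m : nat) (A : {set E}) : R :=
  if m is m'.+1 then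
    c A - \sum_(B : {set E} | B \proper A) cumulant_rec m' B * mu (A :\: B)
  else 0.

Definition cumulant (A : {set E}) : R := cumulant_rec #|A|.+1 A.

Lemma cumulant_rec_stable m m' (A : {set E}) : (#|A| < m)%N -> (#|A| < m')%N ->
  cumulant_rec m A = cumulant_rec m' A.
Proof.
elim: m m' A => [|m IHm] [|m'] A //= ltAm ltAm'; congr (_ - _).
apply: eq_bigr => B /proper_card ltBA; congr (_ * _).
by apply: IHm; apply: leq_trans ltBA _.
Qed.

Lemma cumulantE A :
  cumulant A = c A - \sum_(B : {set E} | B \proper A) cumulant B * mu (A :\: B).
Proof.
rewrite {1}/cumulant /=; congr (_ - _); apply: eq_bigr => B /proper_card ltBA.
by congr (_ * _); apply: cumulant_rec_stable.
Qed.

Lemma cumulant_sum (A : {set E}) : mu set0 = 1 ->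
  \sum_(B : {set E} | B \subset A) cumulant B * mu (A :\: B) = c A.
Proof.
move=> mu0; rewrite (bigD1 A) //= setDv mu0 mulr1 cumulantE.
rewrite [X in _ - X + _](eq_bigl (fun B : {set E} => (B \subset A) && (B != A))).
  by rewrite subrK.
by move=> B; rewrite properEneq andbC.
Qed.

End Cumulants.

(** Choose the steps one by one: a new vertex has at most [#|V|] choices and
    weight 1, a visited one has at most [N] choices and weight [theta], as at
    most [#|S| + m - 1] vertices have been seen before the last step. *)
Lemma sum_revisits_le (R : numDomainType) (V : finType) (theta : R) (N m : nat)
    (S : {set V}) :
    0 <= theta -> (#|S| + m <= N.+1)%N ->
  \sum_(w : m.-tuple V) theta ^+ revisits S w <=
  (#|V|%:R + N%:R * theta) ^+ m.
Proof.
move=> theta_ge0; elim: m S => [|m IHm] S leN.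
  rewrite (eq_bigr (fun=> 1)) => [|w _]; last by rewrite tuple0.
  by rewrite sumr_const card_tuple expn0.
rewrite (sum_tuple_cons _ (fun w => theta ^+ revisits S w)) /=.
have base_ge0 : 0 <= #|V|%:R + N%:R * theta by rewrite addr_ge0 ?mulr_ge0.
apply: le_trans (_ : \sum_x theta ^+ (x \in S) * (#|V|%:R + N%:R * theta) ^+ m
  <= _).
  apply: ler_sum => x _; under eq_bigr do rewrite exprD.
  rewrite -mulr_sumr.
  rewrite ler_wpM2l ?exprn_ge0 //; apply: IHm.
  by apply: leq_trans leN; rewrite addnS -addSn leq_add2r cardsU1; case: (x \in S).
rewrite -mulr_suml exprS ler_wpM2r ?exprn_ge0 // (bigID [in S]) /= addrC.
apply: lerD.
  rewrite (eq_bigr (fun=> 1)) => [|x /negbTE->//].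
  by rewrite sumr_const ler_nat max_card.
rewrite (eq_bigr (fun=> theta)) => [|x ->//].
rewrite sumr_const -[theta *+ _]mulr_natl ler_wpM2r // ler_nat.
by move: leN; rewrite addnS ltnS; apply: leq_trans; rewrite leq_addr.
Qed.

Section SpinCumulants.
Variables (R : realFieldType) (V E : finType) (src tgt : E -> V) (Q : nat).
Variable e0 : E.
Hypothesis neq_ends : src e0 != tgt e0.
Hypothesis simple : forall e f x y,
  joins src tgt e x y -> joins src tgt f x y -> e = f.
Local Notation boundary := (boundary src tgt).
Local Notation incident := (incident src tgt).
Local Notation trail := (trail src tgt).
Local Notation spins := (@spins R V E src tgt Q).
Local Notation moment := (@moment R V E src tgt Q).
Local Notation joint_moment := (@joint_moment R V E src tgt Q e0).
Local Notation coincidence := (@coincidence R V E src tgt Q).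

(** The joint cumulant of [X_e0] and of the [X_e] for [e] in [A]. *)
Definition kappa : {set E} -> R := cumulant moment joint_moment.

(** The vanishing of the moments propagates through the recursion because
    boundaries add up. *)
Lemma kappa_eq0_boundary (A : {set E}) v : boundary A v != incident e0 v ->
  kappa A = 0.
Proof.
have [m] := ubnP #|A|; elim: m A => // m IHm A leAm bA.
rewrite /kappa cumulantE -/kappa (joint_moment_eq0 _ _ bA) sub0r.
rewrite big1 ?oppr0 // => B ltBA.
have [bB|bB] := eqVneq (boundary B v) (incident e0 v); last first.
  by rewrite IHm ?mul0r // (leq_trans (proper_card ltBA)).
have bAB : boundary (A :\: B) v.
  move: bA; rewrite (boundaryID _ _ _ (proper_sub ltBA)) bB.
  by case: incident; case: boundary.
by rewrite (moment_eq0 _ _ bAB) mulr0.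
Qed.

Lemma spinsU l (A B : {set E}) : [disjoint A & B] ->
  spins l (A :|: B) = spins l A * spins l B.
Proof.
by move=> disjAB; rewrite /spins -bigU //=; apply: eq_bigl => e; rewrite !inE.
Qed.

Lemma moment_split (S : {set V}) (A B : {set E}) :
    {in A, forall e, (src e \in S) && (tgt e \in S)} ->
    {in B, forall e, (src e \notin S) && (tgt e \notin S)} ->
  moment (A :|: B) = moment A * moment B
  /\ (src e0 \in S -> tgt e0 \in S ->
      joint_moment (A :|: B) = joint_moment A * moment B).
Proof.
move=> AS BS.
have disjAB : [disjoint A & B].
  rewrite disjoint_subset; apply/subsetP => e eA; rewrite inE; apply/negP => eB.
  by have /andP[sS _] := AS e eA; have /andP[] := BS e eB; rewrite sS.
have locA : depends_only_on S (spins^~ A) by apply: spins_depends_only_on.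
have locB : depends_only_on (~: S) (spins^~ B).
  by apply: spins_depends_only_on => e /BS; rewrite !inE.
split=> [|sS tS].
  rewrite /moment -(mean_independent locA locB).
  by apply: eq_mean => l; rewrite spinsU.
rewrite /joint_moment -(mean_independent (S := S)) //.
  by apply: eq_mean => l; rewrite spinsU ?mulrA.
move=> l l' eq1 eq2; congr (_ * _); first by rewrite /spin !eq1 ?eq2.
exact: locA.
Qed.

(** Cumulants vanish when the variables split into two independent groups.  By
    induction only the graphs [B] on the side [S] of [e0] contribute to the
    recursion, and for these the moment on the other side factors out, leaving
    the system that defines the joint moment on the side [S]. *)
Lemma kappa_eq0_disconnected (S : {set V}) (A : {set E}) e :
    src e0 \in S -> tgt e0 \in S ->
    {in A, forall e, (src e \in S) = (tgt e \in S)} ->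
    e \in A -> src e \notin S ->
  kappa A = 0.
Proof.
move=> sS tS; have [m] := ubnP #|A|;
  elim: m A e => // m IHm A e leAm closedA eA eNS.
pose A1 := [set f in A | src f \in S].
have sA1A : A1 \subset A by apply/subsetP => f; rewrite inE => /andP[].
have ltA1A : A1 \proper A.
  by apply/properP; split=> //; exists e => //; rewrite inE (negbTE eNS) andbF.
have A1S : {in A1, forall f, (src f \in S) && (tgt f \in S)}.
  by move=> f; rewrite inE => /andP[fA fS]; rewrite -closedA // fS.
have A2S : {in A :\: A1, forall f, (src f \notin S) && (tgt f \notin S)}.
  move=> f; rewrite !inE => /andP[+ fA]; rewrite fA /= => fS.
  by rewrite -closedA // fS.
rewrite /kappa cumulantE -/kappa (bigID (fun B : {set E} => B \subset A1)) /=.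
rewrite [X in _ - (_ + X)]big1 ?addr0 => [|B /andP[ltBA]]; last first.
  case/subsetPn=> f fB; rewrite inE (subsetP (proper_sub ltBA) f fB) /= => fS.
  rewrite (IHm B f) ?mul0r //; first exact: leq_trans (proper_card ltBA) _.
  by move=> g /(subsetP (proper_sub ltBA)); apply: closedA.
rewrite (eq_bigl (fun B : {set E} => B \subset A1)) => [|B]; last first.
  case sBA1: (B \subset A1); last by rewrite andbF.
  by rewrite andbT (sub_proper_trans sBA1).
rewrite (eq_bigr (fun B => kappa B * moment (A1 :\: B) * moment (A :\: A1))).
  rewrite -mulr_suml cumulant_sum ?moment0 //.
  have [_ /(_ sS tS) <-] := moment_split A1S A2S.
  rewrite (_ : A1 :|: (A :\: A1) = A) ?subrr //.
  by rewrite -[X in X :|: _](setIidPr sA1A) setID.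
move=> B sBA1; rewrite -mulrA; congr (_ * _).
have [<- _] := @moment_split S (A1 :\: B) (A :\: A1) (fun f fA => A1S f
  (subsetP (subsetDl _ _) f fA)) A2S.
congr moment; apply/setP => f; rewrite !inE.
have := subsetP sBA1 f; rewrite inE.
by case: (f \in B); case: (f \in A); case: (_ \in S) => //= ->.
Qed.

(** The bound [k.+1 ^ k] counts chains of even subgraphs.  By the recursion,
    [kappa B] is a sum over the even [C] in [B] of [kappa (B - C)] times the
    moment on [C].  By hypothesis each [C] is determined by the nonempty set
    [J = F :&: C], and [B - C] has only [k - #|J|] edges in [F]; so
    [1 + \sum_(J != set0) k ^ (k - #|J|) <= (1 + k) ^ k] closes the induction. *)
Lemma kappa_norm_le (F A : {set E}) :
    (forall B : {set E}, B \subset A -> (forall v, boundary B v = false) ->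
       F :&: B = set0 -> B = set0) ->
  forall B : {set E}, B \subset A ->
    `|kappa B| <= #|F :&: B|.+1%:R ^+ #|F :&: B| * coincidence (e0 |: B).
Proof.
move=> chordF B; have [m] := ubnP #|B|; elim: m B => // m IHm B leBm sBA.
set T := F :&: B; set x : R := #|T|%:R.
pose even (C : {set E}) := [forall v, ~~ boundary C v].
rewrite /kappa cumulantE -/kappa; apply: le_trans (ler_normB _ _) _.
pose term (C : {set E}) := x ^+ (#|T| - #|F :&: C|).
have term_ge0 C : 0 <= term C by rewrite exprn_ge0.
have sum_le : `|\sum_(C : {set E} | C \proper B) kappa C * moment (B :\: C)|
    <= (\sum_(C : {set E} | [&& C \subset B, C != set0 & even C]) term C)
       * coincidence (e0 |: B).
  apply: le_trans (ler_norm_sum _ _ _) _.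
  (* Sum over the removed graph [C] instead of the remaining one. *)
  rewrite mulr_suml (reindex_onto (fun C => B :\: C) (fun C => B :\: C)) /=;
    last first.
    by move=> C ltCB; rewrite setDDr setDv set0U (setIidPr (proper_sub ltCB)).
  rewrite [leRHS]big_mkcond [leLHS]big_mkcond; apply: ler_sum => C _.
  case: ifP => [|_]; last first.
    by case: ifP => // _; rewrite mulr_ge0 ?coincidence_ge0.
  case/andP=> ltB /eqP eqC; rewrite eqC.
  have sCB : C \subset B by rewrite -eqC subsetDl.
  have C0 : C != set0.
    by apply: contraTneq ltB => ->; rewrite setD0 properxx.
  have [evC|/forallPn[v /negPn oddC]] := boolP (even C); last first.
    by rewrite (moment_eq0 _ _ oddC) mulr0 normr0 sCB C0.
  rewrite sCB C0 /= normrM.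
  have FC0 : F :&: C != set0.
    apply: contra_neq C0 => FC0; apply: chordF FC0.
      exact: subset_trans sCB sBA.
    by move=> v; apply/negbTE/(forallP evC).
  have eqT : #|F :&: (B :\: C)| = (#|T| - #|F :&: C|)%N.
    rewrite setIDA cardsD -/T; congr (_ - #|pred_of_set _|)%N.
    by rewrite /T -setIA (setIidPr sCB).
  have ltT : (#|F :&: (B :\: C)| < #|T|)%N.
    rewrite eqT ltn_subrL card_gt0 FC0 /=.
    apply: leq_trans (subset_leq_card (setIS F sCB)).
    by rewrite card_gt0.
  have leC : `|kappa (B :\: C)| <= term C * coincidence (e0 |: (B :\: C)).
    apply: le_trans (IHm _ _ _) _.
    - exact: leq_trans (proper_card ltB) _.
    - exact: subset_trans (subsetDl _ _) sBA.
    rewrite ler_wpM2r ?coincidence_ge0 // /term -eqT.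
    by rewrite lerXn2r ?nnegrE ?ler0n // ler_nat.
  apply: le_trans (ler_pM _ _ leC (moment_norm_le _ _ _ _ _)) _ => //.
  rewrite -mulrA ler_wpM2l // (le_trans (coincidenceM_le _ _ _ _ _ _)) //.
  rewrite (_ : (e0 |: (B :\: C)) :|: C = e0 |: B) //.
  rewrite -setUA (_ : B :\: C :|: C = B) //.
  by rewrite setUC -[X in X :|: _](setIidPr sCB) setID.
apply: le_trans (lerD (joint_moment_norm_le _ _ _ _ _ _) sum_le) _.
rewrite -[X in X + _]mul1r -mulrDl ler_wpM2r ?coincidence_ge0 //.
(* Two even graphs with the same trace on [F] have an even symmetric difference
   that avoids [F]. *)
have inj_meet : {in [set C : {set E} | [&& C \subset B, C != set0 & even C]] &,
    injective (setI F)}.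
  move=> C C'; rewrite !inE => /and3P[sC _ evC] /and3P[sC' _ evC'] eqFC.
  pose X := (C :\: C') :|: (C' :\: C).
  have : X = set0.
    apply: chordF.
    - by rewrite subUset !(subset_trans (subsetDl _ _)) // (subset_trans _ sBA).
    - move=> v; rewrite (boundaryID _ _ _ (subsetUl (C :\: C') (C' :\: C))).
      have -> : ((C :\: C') :|: (C' :\: C)) :\: (C :\: C') = C' :\: C.
        by apply/setP => f; rewrite !inE; case: (f \in C); case: (f \in C').
      have := boundaryID src tgt v (subsetIl C C').
      have := boundaryID src tgt v (subsetIr C C').
      rewrite (negbTE (forallP evC v)) (negbTE (forallP evC' v)).
      have -> : C' :\: (C :&: C') = C' :\: C.
        by apply/setP => f; rewrite !inE; case: (f \in C); case: (f \in C').
      have -> : C :\: (C :&: C') = C :\: C'.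
        by apply/setP => f; rewrite !inE; case: (f \in C); case: (f \in C').
      by do 3!case: boundary.
    apply/setP => f; have /setP/(_ f) := eqFC; rewrite !inE.
    by case: (f \in F); case: (f \in C); case: (f \in C').
  move/setP=> X0; apply/setP => f; have := X0 f; rewrite !inE.
  by case: (f \in C); case: (f \in C').
have le_sum : \sum_(C : {set E} | [&& C \subset B, C != set0 & even C]) term C
    <= \sum_(J : {set E} | (J \subset T) && (J != set0)) x ^+ (#|T| - #|J|).
  rewrite (eq_bigl [in [set C : {set E} | [&& C \subset B, C != set0 & even
    C]]]); last first.
    by move=> C; rewrite inE.
  rewrite -(big_imset (fun J : {set E} => x ^+ (#|T| - #|J|)) inj_meet) /=.
  rewrite [leLHS]big_mkcond [leRHS]big_mkcond; apply: ler_sum => J _.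
  case: ifP => [|_]; last by case: ifP; rewrite ?exprn_ge0.
  case/imsetP => C; rewrite inE => /and3P[sCB C0 evC] ->.
  rewrite setIS //=; case: eqP => //= FC0; case/eqP: C0.
  apply: chordF FC0; first exact: subset_trans sCB sBA.
  by move=> v; apply/negbTE/(forallP evC).
apply: le_trans (lerD (lexx 1) le_sum) _.
(* The term [J = set0] is [k ^ k], which is at least the 1 of the joint moment. *)
have := sum_exp_subsets T x; rewrite (bigD1 set0) ?sub0set //= cards0 subn0.
rewrite [1 + x]addrC -natr1 => <-; rewrite lerD2r /x.
by case: #|T| => [|k]; rewrite ?expr0 // -natrX ler1n expn_gt0.
Qed.

Definition walk_edges (x : V) (w : seq V) : {set E} :=
  [set e | has (fun yz => joins src tgt e yz.1 yz.2) (zip (x :: w) w)].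

Lemma trail_walk_edges x p :
  trail x p -> [set e in unzip1 p] = walk_edges x (unzip2 p).
Proof.
elim: p x => [|[f y] p IHp] x /=; first by move=> _; apply/setP=> e; rewrite !inE.
case/andP=> jxy /IHp/setP eq_p; apply/setP => e; have := eq_p e.
rewrite !inE /= => ->; congr (_ || _).
by apply/eqP/idP => [->//|jexy]; apply: simple jexy jxy.
Qed.

Lemma constant_on_trail (A : {set E}) (g : {ffun V -> 'I_Q.+1}) x p :
    g \in constant_on src tgt Q A -> trail x p -> {subset unzip1 p <= A} ->
  {in x :: unzip2 p, forall v, g v = g x}.
Proof.
move/constant_onP => gA; elim: p x => [|[e y] p IHp] x /=.
  by move=> _ _ v; rewrite inE => /eqP ->.
case/andP=> jxy tr_p sub_p v; rewrite inE => /orP[/eqP->//|v_p].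
have sub_p' : {subset unzip1 p <= A}.
  by move=> f fp; apply: sub_p; rewrite inE fp orbT.
rewrite (IHp _ tr_p sub_p' _ v_p).
have eA : e \in A by apply: sub_p; rewrite inE eqxx.
by have := gA e eA; case/orP: jxy => /andP[/eqP-> /eqP->].
Qed.

(** Here [w] lists the inner vertices of an Euler trail.  Its vertex set has
    [#|A| + 1 - k] elements, so the classes are constant along the trail with
    probability [Q.+1 ^- (#|A| - k)], and [k] is also the number of chords. *)
Lemma kappa_walk A : kappa A != 0 ->
  exists w : seq V,
    [/\ (size w).+1 = #|A|, walk_edges (src e0) (rcons w (tgt e0)) = A
      & let k := revisits [set src e0; tgt e0] w in
        `|kappa A| <= k.+1%:R ^+ k * Q.+1%:R^-1 ^+ (#|A| - k)].
Proof.
move=> kA0; set a := src e0; set b := tgt e0.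
have bdA v : boundary A v = (a == v) (+) (b == v).
  by apply/eqP; apply: contraR kA0 => bA; rewrite (kappa_eq0_boundary bA).
have connA (S : {set V}) : a \in S -> b \in S ->
    {in A, forall e, (src e \in S) = (tgt e \in S)} -> {in A, forall e, src e
      \in S}.
  move=> aS bS closedA e eA; apply: contraR kA0 => eNS.
  by rewrite (kappa_eq0_disconnected aS bS closedA eA eNS).
have [p [tr_p last_p uniq_p def_A]] := euler_trail bdA connA.
have size_p : size p = #|A|.
  rewrite -def_A -(size_map fst p) -(card_uniqP uniq_p).
  by apply: eq_card => e; rewrite inE.
have sub_p : {subset unzip1 p <= A} by move=> e; rewrite -def_A inE.
have [w def_w] : exists w, unzip2 p = rcons w b.
  case/lastP: (unzip2 p) last_p => [/= ab|w c];
    last by rewrite last_rcons => ->; exists w.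
  by move: neq_ends; rewrite -/a ab eqxx.
have size_w : (size w).+1 = #|A| by rewrite -size_p -(size_map snd p) -/unzip2
  def_w size_rcons.
exists w; split=> //; first by rewrite -def_w -trail_walk_edges.
set k := revisits _ w => /=.
pose T := [set a] :|: [set v in unzip2 p].
have eq_k : (k + #|T| = #|A|.+1)%N.
  have := revisitsE [set a; b] w; rewrite -/k cards2 neq_ends addn2 size_w => <-.
  congr (_ + #|pred_of_set _|)%N; apply/setP => v.
  by rewrite /T def_w !inE mem_rcons inE orbA.
(* Here the end [b] counts as visited only once the trail has reached it; the
   number of revisits is the same, as both sides have the same vertex set. *)
have eq_r : revisits [set a] (unzip2 p) = k.
  have := revisitsE [set a] (unzip2 p); rewrite -/T cards1 addn1 size_map size_p.
  by rewrite -eq_k => /addIn.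
pose F := [set e in chords [set a] p].
have le_F : (#|F :&: A| <= k)%N.
  apply: leq_trans (subset_leq_card (subsetIl _ _)) _.
  rewrite -eq_r -size_chords; apply: leq_trans (card_size _).
  by apply: subset_leq_card; apply/subsetP => e; rewrite inE.
have chordF (B : {set E}) : B \subset A -> (forall v, boundary B v = false) ->
    F :&: B = set0 -> B = set0.
  move=> sBA evB FB0; apply: (chords_meet_even (S := [set a]) _ tr_p uniq_p).
  - by rewrite inE.
  - by move=> e /(subsetP sBA); rewrite -def_A inE.
  - by move=> v _; apply: evB.
  move=> e ech; apply/negP => eB; have := in_set0 e.
  by rewrite -FB0 !inE ech eB.
apply: le_trans (kappa_norm_le chordF (subxx A)) _.
apply: ler_pM; rewrite ?exprn_ge0 ?coincidence_ge0 //.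
  rewrite -!natrX ler_nat; apply: leq_trans (_ : k.+1 ^ #|F :&: A| <= _)%N.
    by case: #|F :&: A| le_F => // m lemk; rewrite leq_exp2r.
  by rewrite leq_pexp2l.
have -> : (#|A| - k = #|T|.-1)%N by move: eq_k; move: #|T| #|A| => t c; lia.
apply: (@coincidence_le R V E src tgt Q _ _ a); first by rewrite !inE eqxx.
move=> g gA v; rewrite !inE -in_cons; apply: (constant_on_trail gA tr_p).
by move=> e /sub_p eA; rewrite inE eA orbT.
Qed.

Lemma revisits_le_size (S : {set V}) (w : seq V) : (revisits S w <= size w)%N.
Proof.
elim: w S => //= y w IHw S; rewrite -add1n leq_add ?IHw //.
by case: (y \in S).
Qed.

(** With [theta = D^2 * Q.+1^2] as the weight of a revisit, [D_small] keeps the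
    total weight of the visited vertices at most [#|V|], the bound for the new
    ones, and [eta_small] makes the series over the lengths of the trails
    geometric of ratio at most 1/2. *)
Section Sum.
Variables (D : nat) (eta : R).
Hypothesis eta_ge0 : 0 <= eta.
Hypothesis D_small : (D ^ 3 * Q.+1 ^ 2 <= #|V|)%N.
Hypothesis eta_small : 4 * #|V|%:R * eta <= Q.+1%:R ^+ 2.

Let n : R := #|V|%:R.
Let q : R := Q.+1%:R.

Lemma card_V_gt0 : 0 < n.
Proof. by rewrite ltr0n; apply/card_gt0P; exists (src e0). Qed.

(** Every graph with [m.+1] edges is charged to an inner walk of length [m], and
    [k < D] turns [(k + 1)^(2 k) * Q^(2 k)] into a power of [theta]. *)
Lemma kappa_level_le m : (m < D)%N ->
  \sum_(A : {set E} | #|A| == m.+1) kappa A ^+ 2 * eta ^+ #|A| <=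
  2^-1 ^+ m.+1 / (2 * n).
Proof.
move=> ltmD; have n_gt0 := card_V_gt0; have q_gt0 : 0 < q by rewrite ltr0n.
have q_ge0 := ltW q_gt0; have n_ge0 := ltW n_gt0.
have qV_ge0 : 0 <= q^-1 by rewrite invr_ge0.
pose theta : R := (D ^ 2 * Q.+1 ^ 2)%:R.
pose S := [set src e0; tgt e0].
have leH : \sum_(A : {set E} | #|A| == m.+1) kappa A ^+ 2 * eta ^+ #|A| <=
    \sum_(w : m.-tuple V) (eta / q ^+ 2) ^+ m.+1 * theta ^+ revisits S w.
  apply: (ler_sum_cover (h := fun w : m.-tuple V => walk_edges (src e0) (rcons
    w (tgt e0)))).
    by move=> w; rewrite mulr_ge0 ?exprn_ge0 ?divr_ge0 ?ler0n ?exprn_ge0 ?ler0n.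
  move=> A /eqP cardA; rewrite mulf_eq0 negb_or expf_eq0 /= => /andP[kA0 _].
  have [w [size_w walk_w le_k]] := kappa_walk kA0.
  have size_wm : size w == m by rewrite -eqSS size_w cardA.
  exists (Tuple size_wm) => //=; move: le_k => /=; rewrite -/S cardA -/q.
  set k := revisits S w => le_k.
  have lekm : (k <= m)%N by rewrite -(eqP size_wm) revisits_le_size.
  rewrite exprMn -[leRHS]mulrA [leLHS]mulrC ler_wpM2l ?exprn_ge0 //.
  rewrite -exprVn -real_normK ?num_real //.
  apply: le_trans (_ : (k.+1%:R ^+ k * q^-1 ^+ (m.+1 - k)) ^+ 2 <= _).
    by rewrite lerXn2r ?nnegrE ?normr_ge0 // mulr_ge0 ?exprn_ge0 ?invr_ge0 ?ltW.
  have -> : q^-1 ^+ (m.+1 - k) = q^-1 ^+ m.+1 * q ^+ k.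
    rewrite -{2}(subnK (leq_trans lekm (leqnSn m))) exprD -mulrA -exprMn.
    by rewrite mulVf ?gt_eqF // expr1n mulr1.
  rewrite mulrCA exprMn -exprM [(m.+1 * 2)%N]mulnC exprM ler_wpM2l ?exprn_ge0
    ?invr_ge0 //.
  rewrite -exprMn -exprM mulnC exprM lerXn2r ?nnegrE ?exprn_ge0 ?mulr_ge0 ?ler0n //.
  rewrite /theta natrM !natrX exprMn ler_wpM2r ?exprn_ge0 ?ler0n //.
  by rewrite lerXn2r ?nnegrE ?ler0n // ler_nat (leq_ltn_trans lekm).
apply: le_trans leH _; rewrite -mulr_sumr.
have le_sum : \sum_(w : m.-tuple V) theta ^+ revisits S w <= (2 * n) ^+ m.
  apply: le_trans (sum_revisits_le (N := m.+1) _ _) _.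
  - exact: ler0n.
  - by rewrite cards2 neq_ends add2n.
  rewrite lerXn2r ?nnegrE ?addr_ge0 ?mulr_ge0 ?ler0n //.
  rewrite [2 * n]mulr_natl mulr2n lerD2l -natrM ler_nat; apply: leq_trans D_small.
  by rewrite mulnA leq_mul2r (expnS D 2) leq_mul2r ltmD !orbT.
apply: le_trans (ler_wpM2l _ le_sum) _.
  by rewrite exprn_ge0 // divr_ge0 ?exprn_ge0 // ltW.
have n2_neq0 : 2 * n != 0 by rewrite gt_eqF // mulr_gt0.
rewrite -[(2 * n) ^+ m](mulfK n2_neq0) -exprSr mulrA -exprMn.
rewrite ler_pM2r ?invr_gt0 ?mulr_gt0 //.
rewrite lerXn2r ?nnegrE ?invr_ge0 ?mulr_ge0 ?invr_ge0 ?exprn_ge0 //.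
rewrite mulrAC ler_pdivrMr ?exprn_gt0 //.
have := eta_small; rewrite -/n -/q; move: (q ^+ 2) => q2.
move: eta n => x y; lra.
Qed.

Lemma kappa_sum_le :
  \sum_(A : {set E} | (#|A| <= D)%N) kappa A ^+ 2 * eta ^+ #|A| <= (2 * n)^-1.
Proof.
have n_gt0 := card_V_gt0; have n_ge0 := ltW n_gt0.
rewrite (partition_big (fun A : {set E} => inord #|A| : 'I_D.+1) predT) //=.
rewrite (eq_bigr (fun d : 'I_D.+1 =>
    \sum_(A : {set E} | #|A| == d) kappa A ^+ 2 * eta ^+ #|A|)) => [|d _];
      last first.
  apply: eq_bigl => A; apply/andP/eqP => [[leAD /eqP <-]|eqA];
    first by rewrite inordK.
  by rewrite eqA -ltnS ltn_ord inord_val eqxx.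
rewrite big_ord_recl /= big1 ?add0r => [|A /eqP/cards0_eq ->]; last first.
  rewrite (kappa_eq0_boundary (v := src e0)) ?expr0n ?mul0r //.
  rewrite /boundary big_set0 /incident eqxx /=.
  by rewrite [tgt e0 == _]eq_sym (negbTE neq_ends).
apply: le_trans (_ : \sum_(m < D) 2^-1 ^+ m.+1 / (2 * n) <= _).
  by apply: ler_sum => m _; rewrite kappa_level_le.
rewrite -mulr_suml ler_piMl ?invr_ge0 ?mulr_ge0 //.
suff -> : \sum_(m < D) 2^-1 ^+ m.+1 = 1 - 2^-1 ^+ D :> R.
  by rewrite gerBl exprn_ge0 ?invr_ge0.
elim: D => [|d IHd]; first by rewrite big_ord0 expr0 subrr.
rewrite big_ord_recr /= IHd exprS; move: (2^-1 ^+ d) => x; lra.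
Qed.

End Sum.
End SpinCumulants.

(** * Low-degree functions of independent edges *)

Section Bernoulli.
Variables (R : realFieldType) (E : finType).
Local Notation graph := {ffun E -> bool}.

Definition pm1 (b : bool) : R := if b then 1 else -1.

Definition monomial (A : {set E}) (w : graph) : R := \prod_(e in A) pm1 (w e).

(** The law of independent edges for which the sign of [e] has mean [m e]. *)
Definition bernoulli (m : E -> R) (w : graph) : R :=
  \prod_e ((1 + m e * pm1 (w e)) / 2).

Definition centred (m : E -> R) (A : {set E}) (w : graph) : R :=
  \prod_(e in A) (pm1 (w e) - m e).

Lemma bernoulli_centred m (A B : {set E}) :
  \sum_w bernoulli m w * (centred m A w * centred m B w) =
  if A == B then \prod_(e in A) (1 - m e ^+ 2) else 0.
Proof.
pose h e b := (1 + m e * pm1 b) / 2 *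
  ((if e \in A then pm1 b - m e else 1) * (if e \in B then pm1 b - m e else 1)).
rewrite (eq_bigr (fun w : graph => \prod_e h e (w e))) => [|w _]; last first.
  rewrite /bernoulli /centred [X in _ * (X * _)]big_mkcond.
  by rewrite [X in _ * (_ * X)]big_mkcond -!big_split.
rewrite -(bigA_distr_bigA (fun e b => h e b)) /=.
rewrite (eq_bigr (fun e => if (e \in A) && (e \in B) then 1 - m e ^+ 2
    else if (e \in A) || (e \in B) then 0 else 1)) => [|e _]; last first.
  rewrite big_bool /h /pm1.
  by case: (e \in A); case: (e \in B) => /=; field.
have [<-|neqAB] := eqVneq.
  rewrite [RHS]big_mkcond; apply: eq_bigr => e _.
  by case: (e \in A).
have [e eAB] : exists e, (e \in A) != (e \in B).
  apply/existsP; apply: contraNT neqAB; rewrite negb_exists => /forallP eqAB.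
  by apply/eqP/setP => e; apply/eqP; have := eqAB e; rewrite negbK.
by rewrite (bigD1 e) //=; case: (e \in A) (e \in B) eAB => [] [] //= _;
  rewrite mul0r.
Qed.

Lemma monomial_centred m A w :
  monomial A w =
  \sum_(B : {set E} | B \subset A) centred m B w * \prod_(e in A :\: B) m e.
Proof.
rewrite -prod_addr_subsets; apply: eq_bigr => e _.
by rewrite subrK.
Qed.

(** The coefficient on [centred m B] of the polynomial with coefficients [a] on
    the monomials. *)
Definition centred_coef (m : E -> R) (a : {set E} -> R) (B : {set E}) : R :=
  \sum_(A : {set E} | B \subset A) a A * \prod_(e in A :\: B) m e.

Lemma sum_monomial_centred m a w :
  \sum_A a A * monomial A w = \sum_B centred_coef m a B * centred m B w.
Proof.
under eq_bigr => A _ do rewrite (monomial_centred m) mulr_sumr.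
rewrite (exchange_big_dep predT) //=; apply: eq_bigr => B _.
by rewrite mulr_suml; apply: eq_bigr => A _; rewrite mulrCA mulrC.
Qed.

(** The centred products other than the empty one have mean 0. *)
Lemma bernoulli_mean m a :
  \sum_w bernoulli m w * (\sum_A a A * monomial A w) = centred_coef m a set0.
Proof.
under eq_bigr => w _ do rewrite (sum_monomial_centred m) mulr_sumr.
rewrite exchange_big /= (bigD1 set0) //= [X in _ + X]big1 ?addr0 => [|B B0];
  last first.
  rewrite (eq_bigr (fun w => centred_coef m a B *
      (bernoulli m w * (centred m B w * centred m set0 w)))) => [|w _].
    by rewrite -mulr_sumr bernoulli_centred (negbTE B0) mulr0.
  by rewrite [centred m set0 w]big_set0 mulr1 mulrCA.
rewrite (eq_bigr (fun w => centred_coef m a set0 *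
    (bernoulli m w * (centred m set0 w * centred m set0 w)))) => [|w _].
  by rewrite -mulr_sumr bernoulli_centred eqxx big_set0 mulr1.
by rewrite [centred m set0 w]big_set0 !mulr1 mulrC.
Qed.

Lemma bernoulli_parseval m a :
  \sum_w bernoulli m w * (\sum_A a A * monomial A w) ^+ 2 =
  \sum_B centred_coef m a B ^+ 2 * \prod_(e in B) (1 - m e ^+ 2).
Proof.
rewrite (eq_bigr (fun w => \sum_B \sum_C centred_coef m a B * centred_coef m a C *
    (bernoulli m w * (centred m B w * centred m C w)))) => [|w _]; last first.
  rewrite (sum_monomial_centred m) expr2 mulr_suml mulr_sumr.
  apply: eq_bigr => B _; rewrite mulr_sumr mulr_sumr; apply: eq_bigr => C _.
  by ring.
rewrite exchange_big; apply: eq_bigr => B _ /=.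
rewrite exchange_big (bigD1 B) //= [X in _ + X]big1 ?addr0 => [|C neqCB].
  by rewrite -mulr_sumr bernoulli_centred eqxx expr2.
by rewrite -mulr_sumr bernoulli_centred eq_sym (negbTE neqCB) mulr0.
Qed.

Lemma bernoulli_total m : \sum_w bernoulli m w = 1.
Proof.
have := bernoulli_centred m set0 set0; rewrite eqxx big_set0 => <-.
by apply: eq_bigr => w _; rewrite /centred big_set0 !mulr1.
Qed.

(** As the squares of the signs are 1, the multilinear monomials span all
    polynomials, without increasing the degree. *)
Definition low_degree (D : nat) (f : graph -> R) : Prop :=
  exists a : {set E} -> R, (forall A : {set E}, (D < #|A|)%N -> a A = 0)
    /\ forall w, f w = \sum_A a A * monomial A w.

Lemma low_degreeW D D' f : (D <= D')%N -> low_degree D f -> low_degree D' f.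
Proof.
move=> leD [a [a0 eq_f]]; exists a; split=> // A ltA.
by apply: a0; apply: leq_ltn_trans ltA.
Qed.

Lemma low_degree_const D c : low_degree D (fun=> c).
Proof.
exists (fun A => if A == set0 then c else 0); split=> [A|w].
  by case: eqP => // ->; rewrite cards0.
rewrite (bigD1 set0) //= eqxx /monomial big_set0 mulr1 big1 ?addr0 // => A.
by move/negbTE ->; rewrite mul0r.
Qed.

Lemma low_degree_ext D f g : f =1 g -> low_degree D f -> low_degree D g.
Proof. by move=> eq_fg [a [a0 eq_f]]; exists a; split=> // w; rewrite -eq_fg. Qed.

Lemma low_degreeD D f g : low_degree D f -> low_degree D g ->
  low_degree D (fun w => f w + g w).
Proof.
move=> [a [a0 eq_f]] [b [b0 eq_g]]; exists (fun A => a A + b A); split=> [A ltA|w].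
  by rewrite a0 ?b0 ?addr0.
by rewrite eq_f eq_g -big_split; apply: eq_bigr => A _; rewrite mulrDl.
Qed.

Lemma low_degree_sum D (I : Type) (r : seq I) (F : I -> graph -> R) :
    (forall i, low_degree D (F i)) ->
  low_degree D (fun w => \sum_(i <- r) F i w).
Proof.
move=> lowF; elim: r => [|i r IHr].
  by apply: low_degree_ext (low_degree_const D 0) => w; rewrite big_nil.
by apply: low_degree_ext (low_degreeD (lowF i) IHr) => w; rewrite big_cons.
Qed.

Definition symdiff (A B : {set E}) : {set E} := (A :\: B) :|: (B :\: A).

Lemma in_symdiff A B e : (e \in symdiff A B) = (e \in A) (+) (e \in B).
Proof. by rewrite !inE; case: (e \in A); case: (e \in B). Qed.

Lemma symdiffK A : involutive (symdiff A).
Proof. by move=> B; apply/setP=> e; rewrite !in_symdiff addKb. Qed.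

Lemma monomialM A B w : monomial A w * monomial B w = monomial (symdiff A B) w.
Proof.
rewrite /monomial big_mkcond [X in _ * X]big_mkcond [RHS]big_mkcond -big_split.
apply: eq_bigr => e _ /=; rewrite in_symdiff /pm1.
by case: (e \in A); case: (e \in B); case: (w e);
  rewrite /= ?mulr1 ?mul1r ?mulrNN ?mulr1.
Qed.

Lemma low_degreeM D D' f g : low_degree D f -> low_degree D' g ->
  low_degree (D + D') (fun w => f w * g w).
Proof.
move=> [a [a0 eq_f]] [b [b0 eq_g]].
exists (fun C => \sum_A a A * b (symdiff A C)); split=> [C ltC|w].
  apply: big1 => A _; have [leA|/a0->] := leqP #|A| D; last by rewrite mul0r.
  rewrite b0 ?mulr0 //; move: ltC; apply: contraTT; rewrite -!leqNgt => leB.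
  have sC : C \subset A :|: symdiff A C.
    by apply/subsetP=> e; rewrite inE in_symdiff; case: (e \in A); case: (e \in C).
  apply: leq_trans (subset_leq_card sC) _.
  by apply: leq_trans (leq_card_setU _ _) _; apply: leq_add.
rewrite eq_f eq_g mulr_suml.
under [RHS]eq_bigr => C _ do rewrite mulr_suml.
rewrite [RHS]exchange_big; apply: eq_bigr => A _ /=.
rewrite mulr_sumr (reindex_inj (inv_inj (symdiffK A))) /=; apply: eq_bigr => B _.
by rewrite mulrACA monomialM symdiffK.
Qed.

Lemma low_degreeX D f k : low_degree D f -> low_degree (D * k) (fun w => f w ^+ k).
Proof.
move=> lowf; elim: k => [|k IHk].
  by apply: low_degree_ext (low_degree_const _ 1) => w; rewrite expr0.
by rewrite mulnS; apply: low_degree_ext (low_degreeM lowf IHk) => w; rewrite exprS.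
Qed.

Lemma low_degree_prod (I : Type) (r : seq I) (d : I -> nat) (F : I -> graph -> R) :
    (forall i, low_degree (d i) (F i)) ->
  low_degree (\sum_(i <- r) d i)%N (fun w => \prod_(i <- r) F i w).
Proof.
move=> lowF; elim: r => [|i r IHr].
  by apply: low_degree_ext (low_degree_const _ 1) => w; rewrite big_nil.
by rewrite big_cons; apply: low_degree_ext (low_degreeM (lowF i) IHr) => w;
  rewrite big_cons.
Qed.

Lemma low_degree_edge e : low_degree 1 (fun w => (w e)%:R).
Proof.
exists (fun A => if A == set0 then 2^-1 else if A == [set e] then 2^-1 else 0).
split=> [A|w].
  by case: eqP => [->|_]; [rewrite cards0 | case: eqP => // ->; rewrite cards1].
have e0 : [set e] != set0 by apply/set0Pn; exists e; rewrite inE.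
rewrite (bigD1 set0) //= (bigD1 [set e]) //= !eqxx (negbTE e0) big1 ?addr0.
  by rewrite /monomial big_set0 big_set1 /pm1; case: (w e) => /=; field.
by move=> A /andP[/negbTE-> /negbTE->]; rewrite mul0r.
Qed.

End Bernoulli.

(** * The Bayes risk of a low-degree estimator *)

Section Estimation.
Variables (R : realFieldType) (V E : finType) (src tgt : E -> V) (Q : nat).
Variable e0 : E.
Local Notation spin := (@spin R V E src tgt Q).
Local Notation spins := (@spins R V E src tgt Q).
Local Notation moment := (@moment R V E src tgt Q).
Local Notation joint_moment := (@joint_moment R V E src tgt Q e0).
Local Notation kappa := (@kappa R V E src tgt Q e0).
Local Notation mean := (@mean R V Q).

Variable t : R.
Hypothesis t2_lt1 : t ^+ 2 < 1.

Definition edge_mean (l : labelling V Q) (e : E) : R := t * spin l e.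

Lemma prod_edge_mean l (A : {set E}) :
  \prod_(e in A) edge_mean l e = t ^+ #|A| * spins l A.
Proof. by rewrite /edge_mean big_split /= prodr_const. Qed.

Lemma spin_sqr l e : spin l e ^+ 2 = (l.1 \in constant_on src tgt Q [set e])%:R.
Proof.
have -> : (l.1 \in constant_on src tgt Q [set e]) = (l.1 (src e) == l.1 (tgt e)).
  rewrite inE; apply/forall_inP/idP => [-> //|eq_l f]; first by rewrite inE.
  by rewrite inE => /eqP ->.
by rewrite /spin; case: ifP; rewrite ?sqrr_sign ?expr0n.
Qed.

(** The risk is the quadratic form [\sum_B (1 - t^2)^|B| * b_B^2] minus the cross
    term [t * \sum_B kappa_B * t^|B| * b_B], up to the constant
    [t^2 / 4 * E X_e0^2]; minimise over each [b_B] separately, where [b_B = 0]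
    beyond degree [D].  The averages [b_B] over the labels come from Jensen's
    inequality; that the cross term involves the same averages is the system
    that defines [kappa]. *)
Lemma estimation_lower_bound D (f : {ffun E -> bool} -> R) : low_degree D f ->
  t ^+ 2 / 4 * (Q.+1%:R^-1
    - \sum_(A : {set E} | (#|A| <= D)%N)
        kappa A ^+ 2 * (t ^+ 2 / (1 - t ^+ 2)) ^+ #|A|) <=
  mean (fun l =>
    \sum_w bernoulli (edge_mean l) w * (f w - t / 2 * spin l e0) ^+ 2).
Proof.
move=> [a [a0 eq_f]].
have u_gt0 : 0 < 1 - t ^+ 2 by rewrite subr_gt0.
pose b l := centred_coef (edge_mean l) a.
have eq_risk l : \sum_w bernoulli (edge_mean l) w * (f w - t / 2 * spin l e0) ^+ 2 =
    \sum_(B : {set E}) b l B ^+ 2 * \prod_(e in B) (1 - edge_mean l e ^+ 2)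
    + (- t * (spin l e0 * b l set0) + t ^+ 2 / 4 * spin l e0 ^+ 2).
  rewrite /b -bernoulli_parseval -bernoulli_mean.
  rewrite (_ : t ^+ 2 / 4 * _ =
    t ^+ 2 / 4 * spin l e0 ^+ 2 * \sum_w bernoulli (edge_mean l) w); last first.
    by rewrite bernoulli_total mulr1.
  rewrite mulrA !mulr_sumr -!big_split /=; apply: eq_bigr => w _.
  rewrite -eq_f; move: (spin l e0) (f w) (bernoulli _ _) => x y z.
  by field.
rewrite (eq_mean eq_risk) !meanD !meanZ.
pose B_ (B : {set E}) := mean (fun l => b l B).
have eq_B B : B_ B =
    \sum_(A : {set E} | B \subset A) a A * (t ^+ #|A :\: B| * moment (A :\: B)).
  rewrite /B_ /b /centred_coef mean_sum; apply: eq_bigr => A _.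
  rewrite meanZ; congr (_ * _); rewrite -meanZ; apply: eq_mean => l.
  exact: prod_edge_mean.
have le_energy : \sum_(B : {set E}) (1 - t ^+ 2) ^+ #|B| * B_ B ^+ 2 <=
    mean (fun l =>
      \sum_(B : {set E}) b l B ^+ 2 * \prod_(e in B) (1 - edge_mean l e ^+ 2)).
  rewrite mean_sum; apply: ler_sum => B _.
  apply: le_trans (_ : (1 - t ^+ 2) ^+ #|B| * mean (fun l => b l B ^+ 2) <= _).
    by rewrite ler_wpM2l ?exprn_ge0 ?mean_sqr_le // ltW.
  rewrite -meanZ; apply: mean_le => l; rewrite mulrC ler_wpM2l ?sqr_ge0 //.
  rewrite -prodr_const; apply: ler_prod => e _; rewrite ltW //=.
  rewrite lerD2l lerN2 /edge_mean exprMn ler_piMr ?sqr_ge0 // spin_sqr.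
  by case: (_ \in _).
have eq_cross : mean (fun l => spin l e0 * b l set0) =
    \sum_(B : {set E}) kappa B * t ^+ #|B| * B_ B.
  transitivity (\sum_(A : {set E}) a A * (t ^+ #|A| * joint_moment A)).
    rewrite (eq_mean (g := fun l =>
        \sum_(A : {set E}) a A * (t ^+ #|A| * (spin l e0 * spins l A)))).
      by rewrite mean_sum; apply: eq_bigr => A _; rewrite !meanZ.
    move=> l; rewrite /b /centred_coef mulr_sumr; apply: eq_big => [A|A _].
      by rewrite sub0set.
    by rewrite setD0 prod_edge_mean mulrCA; congr (_ * _); rewrite mulrCA.
  under [RHS]eq_bigr => B _ do rewrite eq_B mulr_sumr.
  rewrite (exchange_big_dep predT) //=; apply: eq_bigr => A _.
  rewrite -(cumulant_sum joint_moment A (moment0 R src tgt Q)) !mulr_sumr.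
  apply: eq_bigr => B sBA.
  have -> : t ^+ #|A| = t ^+ #|B| * t ^+ #|A :\: B|.
    by rewrite -exprD cardsD (setIidPr sBA) subnKC ?subset_leq_card.
  by rewrite -/(kappa B); move: (kappa B) (moment _) => x y; ring.
have le_sqr : Q.+1%:R^-1 <= mean (fun l => spin l e0 ^+ 2).
  rewrite (eq_mean (fun l => spin_sqr l e0)) mean_constant_on.
  exact: coincidence1_ge.
rewrite eq_cross mulNr mulr_sumr.
(* Completing the square in each averaged coefficient [B_ B]. *)
have le_quad : - (t ^+ 2 / 4 * \sum_(A : {set E} | (#|A| <= D)%N)
      kappa A ^+ 2 * (t ^+ 2 / (1 - t ^+ 2)) ^+ #|A|) <=
    \sum_(B : {set E}) (1 - t ^+ 2) ^+ #|B| * B_ B ^+ 2 -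
    \sum_(B : {set E}) t * (kappa B * t ^+ #|B| * B_ B).
  rewrite mulr_sumr -sumrB -sumrN big_mkcond; apply: ler_sum => B _.
  case: ifP => [_|/negbT]; last first.
    rewrite -ltnNge => ltB; rewrite eq_B big1 ?expr0n ?mulr0 ?subrr //.
    move=> A sBA; rewrite a0 ?mul0r //; apply: leq_trans ltB _.
    exact: subset_leq_card.
  rewrite expr_div_n; set u := (1 - t ^+ 2) ^+ #|B|.
  have {}u_gt0 : 0 < u by rewrite exprn_gt0.
  rewrite -exprM mulnC exprM; move: (t ^+ #|B|) (kappa B) (B_ B) => T k y.
  rewrite -subr_ge0.
  have -> : u * y ^+ 2 - t * (k * T * y) - - (t ^+ 2 / 4 * (k ^+ 2 * (T ^+ 2 /
    u))) =
      (u * y - t * k * T / 2) ^+ 2 / u.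
    by field; rewrite gt_eqF.
  by rewrite divr_ge0 ?sqr_ge0 ?ltW.
have t4_ge0 : 0 <= t ^+ 2 / 4 by rewrite divr_ge0 ?sqr_ge0.
have le_sqr' := ler_wpM2l t4_ge0 le_sqr.
rewrite mulrBr; move: le_quad le_energy le_sqr'.
move: (mean _) (t ^+ 2 / 4 * mean _) (t ^+ 2 / 4 / _) (t ^+ 2 / 4 * _).
move: (\sum_B (1 - _) ^+ _ * _) (\sum_(B : {set E}) t * _) => s1 s2 x1 x2 x3 x4.
lra.
Qed.

End Estimation.

(** * Graphs as sets of edges *)

Section CompleteGraph.
Variable n : nat.

Definition upper : {set 'I_n * 'I_n} := [set e : 'I_n * 'I_n | (e.1 < e.2)%N].
Definition edge : Type := {e | e \in upper}.
HB.instance Definition _ := Finite.on edge.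

Definition fst_end (e : edge) : 'I_n := (val e).1.
Definition snd_end (e : edge) : 'I_n := (val e).2.

Lemma edge_lt (e : edge) : (fst_end e < snd_end e)%N.
Proof. by have := valP e; rewrite inE. Qed.

Lemma edge_neq (e : edge) : fst_end e != snd_end e.
Proof. by apply: contraTneq (edge_lt e) => ->; rewrite ltnn. Qed.

Lemma edge_simple (e f : edge) x y :
  joins fst_end snd_end e x y -> joins fst_end snd_end f x y -> e = f.
Proof.
have lt_e := edge_lt e; have lt_f := edge_lt f.
suff suff_ef : fst_end e = fst_end f -> snd_end e = snd_end f -> e = f.
  case/orP=> /andP[/eqP eq1 /eqP eq2] /orP[] /andP[/eqP eq3 /eqP eq4].
  - by apply: suff_ef; rewrite ?eq1 ?eq2 ?eq3 ?eq4.
  - by move: lt_e lt_f; rewrite eq1 eq2 eq3 eq4 => /ltnW;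
    rewrite leqNgt => /negbTE->.
  - by move: lt_e lt_f; rewrite eq1 eq2 eq3 eq4 => /ltnW;
    rewrite leqNgt => /negbTE->.
  - by apply: suff_ef; rewrite ?eq1 ?eq2 ?eq3 ?eq4.
move=> eq1 eq2; apply: val_inj; rewrite [LHS]surjective_pairing.
by rewrite -/(fst_end e) -/(snd_end e) eq1 eq2 -surjective_pairing.
Qed.

Lemma big_edges (T : Type) (idx : T) (op : Monoid.com_law idx)
    (F : 'I_n -> 'I_n -> T) :
  \big[op/idx]_(i < n) \big[op/idx]_(j < n | (i < j)%N) F i j =
  \big[op/idx]_(e : edge) F (fst_end e) (snd_end e).
Proof.
rewrite pair_big_dep /= (eq_bigl [in upper]) => [|e]; last by rewrite inE.
by rewrite big_sub.
Qed.

Lemma card_edge : #|{: edge}| = 'C(n, 2).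
Proof.
rewrite -sum1_card -(big_edges _ (fun _ _ => 1%N)) /= -bin2_sum big_mkord.
rewrite (exchange_big_dep predT) //=; apply: eq_bigr => j _.
rewrite -[RHS]card_ord -sum1_card (big_ord_widen _ (fun=> 1%N) (ltnW (ltn_ord j))).
by [].
Qed.

Definition adjacency (w : {ffun edge -> bool}) : 'M[bool]_n :=
  \matrix_(i, j) if insub (i, j) is Some e then w e
                 else if insub (j, i) is Some e then w e else false.

Lemma adjacency_edge w e : adjacency w (fst_end e) (snd_end e) = w e.
Proof. by rewrite mxE -surjective_pairing valK. Qed.

Lemma adjacency_sym w i j : adjacency w i j = adjacency w j i.
Proof.
rewrite !mxE; case: insubP => [e lt_ij _|_]; last by case: insubP.
case: insubP => // f lt_ji _; move: lt_ij lt_ji; rewrite !inE /= => /ltnW.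
by rewrite leqNgt => /negbTE ->.
Qed.

Lemma is_adjacency_adjacency w : is_adjacency (adjacency w).
Proof.
apply/andP; split.
  by apply/eqP/matrixP => i j; rewrite mxE adjacency_sym.
apply/forallP => i; rewrite mxE insubF //.
by rewrite inE ltnn.
Qed.

Lemma adjacencyK (A : 'M[bool]_n) : is_adjacency A ->
  adjacency [ffun e => A (fst_end e) (snd_end e)] = A.
Proof.
case/andP=> /eqP/matrixP symA /forallP diagA; apply/matrixP => i j.
rewrite mxE; case: insubP => [e _ def_e|];
  first by rewrite ffunE /fst_end /snd_end def_e.
rewrite inE /= -leqNgt => leji.
case: insubP => [e _ def_e|].
  by rewrite ffunE /fst_end /snd_end def_e -[LHS]symA mxE.
rewrite inE /= -leqNgt => leij; have -> : i = j by apply/val_inj/anti_leq/andP.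
by apply/esym/negbTE.
Qed.

Lemma graph_expectationE (R : realType) (M : 'M[R]_n) (F : 'M[bool]_n -> R) :
  graph_expectation M F =
  \sum_(w : {ffun edge -> bool}) (\prod_e (if w e then M (fst_end e) (snd_end e)
                   else 1 - M (fst_end e) (snd_end e))) * F (adjacency w).
Proof.
rewrite /graph_expectation.
rewrite (reindex_onto adjacency (fun A : 'M[bool]_n =>
    [ffun e => A (fst_end e) (snd_end e)])) => [|A]; last exact: adjacencyK.
apply: eq_big => [w|w _].
  rewrite is_adjacency_adjacency /=; apply/eqP/ffunP => e.
  by rewrite ffunE adjacency_edge.
congr (_ * _); rewrite /graph_prob big_edges; apply: eq_bigr => e _.
by rewrite adjacency_edge.
Qed.

Lemma low_degree_adjacency (R : realType) i j :
  low_degree 1 (fun w => (adjacency w i j)%:R : R).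
Proof.
case: (insubP edge (i, j)) => [e _ def_e|not_ij].
  apply: low_degree_ext (low_degree_edge R e) => w.
  by rewrite -(adjacency_edge w) /fst_end /snd_end def_e.
case: (insubP edge (j, i)) => [e _ def_e|not_ji].
  apply: low_degree_ext (low_degree_edge R e) => w.
  by rewrite adjacency_sym -(adjacency_edge w) /fst_end /snd_end def_e.
apply: low_degree_ext (low_degree_const _ 1 0) => w.
by rewrite mxE !insubF //; apply/negbTE.
Qed.

(** Each entry of the adjacency matrix is an edge variable or 0. *)
Lemma low_degree_estimate (R : realType) D (P : poly_estimator R n) i j :
  degree_le D P -> low_degree D (fun w => estimate P (adjacency w) i j).
Proof.
move=> degP; pose Y w : 'M[R]_n := \matrix_(i, j) (adjacency w i j)%:R.
apply: (@low_degree_ext R _ D (fun w : {ffun edge -> bool} =>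
  \sum_(m <- msupp (P i j))
    if (mdeg m <= D)%N then
      mcoeff m (P i j) * \prod_(k < n * n) (mxvec (Y w) 0 k) ^+ m k else 0) _).
  move=> w /=; rewrite mxE mevalE big_seq [RHS]big_seq; apply: eq_bigr => m.
  move=> /msize_mdeg_lt lt_m.
  by rewrite -ltnS (leq_trans lt_m (degP i j)).
apply: low_degree_sum => m.
have [le_m|_] := leqP (mdeg m) D; last exact: low_degree_const.
apply: (low_degreeW (D := (0 + mdeg m)%N)); first by rewrite add0n.
apply: low_degreeM; first exact: low_degree_const.
rewrite mdegE.
apply: (@low_degree_prod R _ _ _ _ (fun k w => mxvec (Y w) 0 k ^+ m k)) => k.
rewrite -[X in low_degree X _]mul1n; apply: low_degreeX => //.
case/mxvec_indexP: k => k l.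
by apply: low_degree_ext (low_degree_adjacency R k l) => w; rewrite mxvecE [RHS]mxE.
Qed.

End CompleteGraph.

(** * The planted prior *)

Section Prior.
Variables (R : realType) (n q Q : nat) (t : R).
Hypothesis t_ge0 : 0 <= t.
Hypothesis t_le1 : t <= 1.
Hypothesis le_Qq : (Q.+1.*2 <= q)%N.
Local Notation fst_end := (@fst_end n).
Local Notation snd_end := (@snd_end n).

Definition planted (l : labelling 'I_n Q) : 'M[R]_n :=
  \matrix_(i, j) ((2^-1 + t / 2 * (if l.1 i == l.1 j
    then (-1) ^+ (l.2 i (+) l.2 j) else 0)) * (i != j)%:R).

(** The block of a vertex is twice its class plus its sign bit. *)
Lemma planted_block l : block_model q (planted l).
Proof.
have half01 (b c : bool) : 0 <= 2^-1 + t / 2 * (if c then (-1) ^+ b else 0) <= 1.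
  by move: t_ge0 t_le1; case: b; case: c; rewrite ?expr1 ?expr0; lra.
split=> [i j|].
  by rewrite mxE; case: (i != j); rewrite ?mulr1 ?mulr0 // lexx ler01.
have lt_q i : ((l.1 i).*2 + l.2 i < q)%N.
  apply: leq_trans le_Qq; have := ltn_ord (l.1 i).
  by case: (l.2 i) => /=; lia.
exists (\matrix_(a, b) (2^-1 + t / 2 * (if a./2 == b./2
    then (-1) ^+ (odd a (+) odd b) else 0))), (fun i => Ordinal (lt_q i)).
split=> [|a b|i j]; last 1 first.
- rewrite !mxE /= !oddD !odd_double /= !oddb.
  by rewrite ![(_.*2 + _)%N]addnC !half_bit_double.
- by apply/matrixP => a b; rewrite !mxE eq_sym addbC.
by rewrite mxE.
Qed.

Lemma planted_edge l e : planted l (fst_end e) (snd_end e) =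
  2^-1 + t / 2 * spin R fst_end snd_end l e.
Proof. by rewrite mxE edge_neq mulr1. Qed.

Lemma risk_planted l P :
  risk P (planted l) = 'C(n, 2)%:R^-1 *
    \sum_(e : edge n) \sum_(w : {ffun edge n -> bool})
      bernoulli (edge_mean fst_end snd_end t l) w *
      (estimate P (adjacency w) (fst_end e) (snd_end e) - 2^-1
       - t / 2 * spin R fst_end snd_end l e) ^+ 2.
Proof.
rewrite /risk graph_expectationE exchange_big mulr_sumr /=; apply: eq_bigr => w _.
rewrite /loss big_edges mulrCA; congr (_ * _); rewrite mulr_sumr.
apply: eq_bigr => e _; congr (_ * _); last by rewrite planted_edge opprD addrA.
apply: eq_bigr => f _; rewrite planted_edge /edge_mean /pm1.
by case: (w f); field.
Qed.

End Prior.

Lemma exists_ge_mean (R : realFieldType) (V : finType) (Q : nat) (b : R)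
    (f : labelling V Q -> R) :
  b <= mean f -> exists l, b <= f l.
Proof.
move=> le_b; apply/existsP; apply: contraLR le_b; rewrite negb_exists -ltNge.
move=> /forallP lt_f; rewrite -[ltRHS](mean_const V Q) /mean.
rewrite ltr_pM2l ?invr_gt0 ?card_labelling_gt0 //.
apply: ltr_sum => [|l _]; last by rewrite ltNge lt_f.
by apply/hasP; exists ([ffun=> ord0], [ffun=> true]); rewrite ?mem_index_enum.
Qed.

(** With [t^2 = Q^2 / (8 n)] and [t^2 <= 1/8] the weight [t^2 / (1 - t^2)] is at
    most [Q^2 / (7 n)], below the threshold [Q^2 / (4 n)] of [kappa_sum_le].  The
    loss [1 / (2 n)] is at most half of the variance [1 / Q]. *)
Lemma risk_lower_bound (R : realType) (n q Q D : nat) (P : poly_estimator R n) :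
    degree_le D P -> (Q.+1.*2 <= q)%N -> (1 < n)%N ->
    (Q.+1 ^ 2 <= n)%N -> (D ^ 3 * Q.+1 ^ 2 <= n)%N ->
  exists2 M : 'M[R]_n, block_model q M & Q.+1%:R / (64 * n%:R) <= risk P M.
Proof.
move=> degP le_Qq n_gt1 le_Q2n le_DQ.
have n_gt0 : 0 < n%:R :> R by rewrite ltr0n ltnW.
have Qle : Q.+1%:R ^+ 2 <= n%:R :> R by rewrite -natrX ler_nat.
have Q_gt0 : 0 < Q.+1%:R :> R by rewrite ltr0n.
pose t : R := Num.sqrt (Q.+1%:R ^+ 2 / (8 * n%:R)).
have t2E : t ^+ 2 = Q.+1%:R ^+ 2 / (8 * n%:R).
  by rewrite sqr_sqrtr // divr_ge0 ?exprn_ge0 ?mulr_ge0 // ltW.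
have t2_le : t ^+ 2 <= 8^-1.
  by rewrite t2E ler_pdivrMr ?mulr_gt0 // mulrA mulVf ?mul1r.
have t_ge0 : 0 <= t by rewrite sqrtr_ge0.
have t_le1 : t <= 1 by rewrite -(expr_le1 (n := 2)) //; lra.
have t2_lt1 : t ^+ 2 < 1 by lra.
have u_gt0 : 0 < 1 - t ^+ 2 by lra.
pose eta := t ^+ 2 / (1 - t ^+ 2).
have eta_ge0 : 0 <= eta by rewrite divr_ge0 ?sqr_ge0 // ltW.
have eta_small : 4 * #|'I_n|%:R * eta <= Q.+1%:R ^+ 2.
  rewrite card_ord /eta mulrA ler_pdivrMr // t2E.
  have -> : 4 * n%:R * (Q.+1%:R ^+ 2 / (8 * n%:R)) = Q.+1%:R ^+ 2 / 2 :> R.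
    by field; rewrite gt_eqF.
  rewrite -t2E ler_wpM2l ?sqr_ge0 //; lra.
have D_small : (D ^ 3 * Q.+1 ^ 2 <= #|'I_n|)%N by rewrite card_ord.
have [l le_l] : exists l : labelling 'I_n Q,
    Q.+1%:R / (64 * n%:R) <= risk P (planted t l); last first.
  by exists (planted t l); first exact: planted_block.
apply: (@exists_ge_mean R _ Q _ (fun l => risk P (planted t l))).
rewrite (eq_mean (fun l => risk_planted t l P)).
rewrite meanZ mean_sum [leRHS]mulrC ler_pdivlMr ?ltr0n ?bin_gt0 //.
rewrite -card_edge; set b := _ / _.
have -> : b * #|{: edge n}|%:R = \sum_(e : edge n) b by rewrite sumr_const
  mulr_natr.
apply: ler_sum => e _.
pose f (w : {ffun edge n -> bool}) :=
  estimate P (adjacency w) (fst_end e) (snd_end e) - 2^-1.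
have low_f : low_degree D f.
  by apply: low_degreeD (low_degree_const _ _ _); apply: low_degree_estimate.
have := @estimation_lower_bound R _ _ (@fst_end n) (@snd_end n) Q e t t2_lt1 D
  f low_f.
apply: le_trans; rewrite -/eta.
have := kappa_sum_le (edge_neq e) (@edge_simple n) eta_ge0 D_small eta_small.
rewrite card_ord; move: (\sum_(A : {set edge n} | _) _) => W le_W.
apply: le_trans (_ : t ^+ 2 / 4 * (Q.+1%:R^-1 - (2 * n%:R)^-1) <= _); last first.
  by rewrite ler_wpM2l ?divr_ge0 ?sqr_ge0 // lerD2l lerN2.
apply: le_trans (_ : t ^+ 2 / 4 * (2^-1 * Q.+1%:R^-1) <= _).
  rewrite /b t2E le_eqVlt; apply/orP; left; apply/eqP; field.
  by rewrite !gt_eqF.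
rewrite ler_wpM2l ?divr_ge0 ?sqr_ge0 //.
have : n%:R^-1 <= Q.+1%:R^-1 :> R.
  rewrite lef_pV2 ?posrE // ler_nat; apply: leq_trans le_Q2n.
  by rewrite -[leqLHS]expn1 leq_pexp2l.
rewrite [(2 * _)^-1]invfM; move: n%:R^-1 Q.+1%:R^-1 => x y; lra.
Qed.

Theorem corollary1p6 (R : realType) :
  exists2 C : R, 0 < C &
  forall eps : R, 0 < eps ->
  exists2 c : R, 0 < c &
  forall n q D : nat,
    (2 <= q)%N -> q%:R <= n%:R `^ (2^-1 - eps) ->
    D%:R <= n%:R `^ c ->
    ((C * q%:R / n%:R)%:E <= minimax_risk R n q D)%E.
Proof.
(* [192 = 64 * 3], as [q <= 3 * q./2]. *)
exists 192^-1; first by rewrite invr_gt0.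
move=> eps eps_gt0; exists (eps / 2); first by rewrite divr_gt0.
move=> n q D q_ge2 le_q le_D.
have q_ge2R : 2 <= q%:R :> R by rewrite ler_nat.
have n_gt0 : (0 < n)%N.
  rewrite lt0n; apply: contraTneq le_q => ->; rewrite -ltNge.
  apply: le_lt_trans (_ : 1 < _); last by lra.
  by rewrite /powR eqxx; case: (_ == 0).
have n_gt0R : 0 < n%:R :> R by rewrite ltr0n.
have n_ge1R : 1 <= n%:R :> R by rewrite ler1n.
pose x := n%:R `^ eps : R.
have x_ge1 : 1 <= x.
  by rewrite -(powRr0 n%:R) ler_powR // ltW.
have x_gt0 : 0 < x by lra.
have x_ge0 := ltW x_gt0; have n_ge0R := ltW n_gt0R.
have le_q2 : q%:R ^+ 2 <= n%:R / x ^+ 2 :> R.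
  apply: le_trans (_ : (n%:R `^ (2^-1 - eps)) ^+ 2 <= _).
    by rewrite lerXn2r ?nnegrE ?powR_ge0.
  rewrite -powR_mulrn ?powR_ge0 // -powRrM.
  rewrite -[x ^+ 2]powR_mulrn // -powRrM -powRN -{2}[n%:R]powRr1 //.
  rewrite -powRD; last by rewrite (gt_eqF n_gt0R) implybT.
  apply: ler_powR => //; lra.
have le_q2n : (q ^ 2 <= n)%N.
  rewrite -(ler_nat R) natrX (le_trans le_q2) // ler_piMr // //.
  by rewrite invf_le1 ?exprn_gt0 // expr_ge1 // ltW.
have le_D2 : D%:R ^+ 2 <= x.
  apply: le_trans (_ : (n%:R `^ (eps / 2)) ^+ 2 <= _).
    by rewrite lerXn2r ?nnegrE ?powR_ge0.
  by rewrite -powR_mulrn ?powR_ge0 // -powRrM divfK.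
have le_D3 : D%:R ^+ 3 <= x ^+ 2.
  apply: le_trans (_ : (D%:R ^+ 2) ^+ 2 <= _).
    rewrite -exprM -!natrX ler_nat.
    by case: D {le_D le_D2} => // D; rewrite leq_pexp2l.
  by rewrite lerXn2r ?nnegrE ?exprn_ge0.
have [Q def_Q] : exists Q, q./2 = Q.+1.
  by exists (q./2).-1; rewrite prednK // half_gt0.
have le_Qq : (Q.+1.*2 <= q)%N by rewrite -def_Q -[leqRHS]odd_double_half leq_addl.
have le_Q2 : (Q.+1 ^ 2 <= q ^ 2)%N.
  by rewrite leq_exp2r // (leq_trans _ le_Qq) // -addnn leq_addr.
have le_DQ : (D ^ 3 * Q.+1 ^ 2 <= n)%N.
  rewrite -(ler_nat R) natrM natrX.
  apply: le_trans (_ : x ^+ 2 * (n%:R / x ^+ 2) <= _); last first.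
    by rewrite mulrCA divff ?mulr1 // expf_neq0 // gt_eqF.
  apply: ler_pM; rewrite ?exprn_ge0 //; apply: le_trans le_q2.
  by rewrite -natrX ler_nat.
have n_gt1 : (1 < n)%N.
  apply: leq_trans le_q2n; apply: (leq_trans q_ge2).
  by rewrite -[leqLHS]expn1 leq_pexp2l // (ltnW q_ge2).
have le_qQ : q%:R <= 3 * Q.+1%:R :> R.
  rewrite -natrM ler_nat -[leqLHS]odd_double_half def_Q.
  by rewrite mulSn -mul2n leq_add2r; case: (odd q).
apply: le_ereal_inf_tmp => _ [P degP <-].
have [M blockM le_M] := risk_lower_bound degP le_Qq n_gt1 (leq_trans le_Q2
  le_q2n) le_DQ.
apply: (@le_trans _ _ (risk P M)%:E); last by apply: ereal_sup_ubound; exists M.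
rewrite lee_fin (le_trans _ le_M) // invfM [leRHS]mulrA ler_wpM2r ?invr_ge0 //.
lra.
Qed.
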